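(* Let $s>1$, let $\lambda,\kappa\in\mathbb R$, $t>0$, and let $\mathfrak F^{2d}_p$, $\mathfrak P^{2d}_p$ be the deterministic and stochastic discretisation maps of the cubic stochastic nonlinear Schrödinger equation on $\mathbb T$ defined in the context. Assume: (i) $\Phi$ is a self-adjoint Hilbert–Schmidt operator $L^2(\mathbb T)\to H^2(\mathbb T)$, diagonal in Fourier space, whose Fourier coefficients satisfy $\Phi_k^*=\Phi_k$ and $\Phi_k=\Phi_{-k}$ for all $k\in\mathbb Z$; (ii) the real coefficients satisfy $$b_\alpha^{(i)}b_{\tilde\alpha}^{(j)}-b_\alpha^{(i)}a^{(j)}_{\alpha,\tilde\alpha}-b^{(j)}_{\tilde\alpha}a^{(i)}_{\tilde\alpha,\alpha}=0\qquad\text{for all }\alpha,\tilde\alpha\in D,\ i,j\in\{0,1\};$$ (iii) $\Re\int_{\mathbb T}\overline u\,\mathfrak F^{2d}_p(t;c_q;u)\,dx=0$ and $\Re\int_{\mathbb T}\overline u\,\mathfrak P^{2d}_p(t;c_q;u)\,dx=0$ for all $u\in H^s(\mathbb T)$ and all $0\le p,q\le S$. Then the stochastic Runge–Kutta scheme $$u_{n+1}=e^{it\partial_x^2}u_n+t\,e^{it\partial_x^2}\sum_{\alpha\in D}b^{(0)}_\alpha K_\alpha+\sqrt t\,e^{it\partial_x^2}\sum_{\alpha\in D}b^{(1)}_\alpha L_\alpha,$$ $$U_\alpha=u_n+t\sum_{\tilde\alpha\in D}a^{(0)}_{\alpha,\tilde\alpha}K_{\tilde\alpha}+\sqrt t\sum_{\tilde\alpha\in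 D}a^{(1)}_{\alpha,\tilde\alpha}L_{\tilde\alpha},\qquad K_\alpha=\mathfrak F^{2d}_p(t;c_q;U_\alpha),\quad L_\alpha=\mathfrak P^{2d}_p(t;c_q;U_\alpha)\quad(\alpha=(p,q,r)\in D)$$ is symplectic, i.e. almost surely $$\int_{\mathbb T}du_{n+1}\wedge d\overline{u}_{n+1}\,dx=\int_{\mathbb T}du_n\wedge d\overline u_n\,dx .$$
   Context: $\mathbb T$ is the one-dimensional torus, $u_k$ is the $k$-th Fourier coefficient of $u$. $D=\{(p,q,r)\in\mathbb N_0^3:0\le p,q,r\le S\}$ for a fixed $S\in\mathbb N_0$; $c_0,\dots,c_S\in[0,1]$; $a^{(i)}_{\alpha,\tilde\alpha},b^{(i)}_\alpha\in\mathbb R$ for $\alpha,\tilde\alpha\in D$, $i=0,1$. Noise: $(W_k)_{k\in\mathbb Z}$ are real-valued standard Brownian motions with $W_{-k}=\overline{W_k}=W_k$, independent for distinct $k\ge0$. Stratonovich integrals ($\circ\, dW$) of deterministic integrands are ordinary Wiener integrals. At step $n$ of the scheme $W_k(s)$ is replaced by the increment $W_k(nt+s)-W_k(nt)$. Interpolation: fix $d\ge1$ and distinct $0\le\gamma_1<\dots<\gamma_d\le1$; $P_d[f]$ is the unique polynomial of degree at most $d-1$ with $P_d[f](t\gamma_j)=f(t\gamma_j)$, $j=1,\dots,d$. Here $e^{i\,\cdot\,a}$ denotes $s\mapsto e^{isa}$. Kernel: $$\mathcal K_{2d}(s;k,k_1,k_2,k_3)=e^{-2iskk_1}P_d[e^{2i\cdot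 k_2k_3}](s)+e^{2isk_2k_3}P_d[e^{-2i\cdot kk_1}](s)-P_d[e^{2i\cdot k_2k_3}](s)\,P_d[e^{-2i\cdot kk_1}](s).$$ Discretisation maps: $$\mathfrak F^{2d}_p(t;c_q;v)=-i\lambda\sum_{k\in\mathbb Z}e^{ikx}\sum_{k+k_1=k_2+k_3}\frac1{t^{p+1}}\int_0^{c_qt}\mathcal K_{2d}(s;k,k_1,k_2,k_3)s^p\,ds\;\overline{v_{k_1}}v_{k_2}v_{k_3},$$ $$\mathfrak P^{2d}_p(t;c_q;v)=-i\kappa\sum_{k\in\mathbb Z}e^{ikx}\frac1{t^{p+\frac12}}\sum_{k=k_1+k_2}v_{k_1}\Phi_{k_2}\int_0^{c_qt}P_d[e^{i\cdot(kk_2+k_1k_2)}](s)\,s^p\circ dW_{k_2}(s).$$ Meaning of symplecticity: up to a constant normalisation, $\int_{\mathbb T}du\wedge d\overline u\,dx=\sum_{k\in\mathbb Z}du_k\wedge d\overline{u_k}$, i.e. the two-form $\omega(a,b)=\sum_k(a_k\overline{b_k}-b_k\overline{a_k})$ on $H^s(\mathbb T)$ viewed as a real vector space. The scheme is implicit; for a fixed realisation of the noise the identity is understood for tangent vectors at $u_n$ wherever the implicit stage equations have solutions $K_\alpha,L_\alpha$ depending ($H^s$-valued) real-continuously-differentiably on $u_n\in H^s(\mathbb T)$: the derivative of $u_n\mapsto u_{n+1}$ preserves $\omega$. *)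

(* Defs.v *)
From HB Require Import structures.
From mathcomp Require Import all_boot all_order all_algebra.
From mathcomp Require Import complex.
From mathcomp Require Import all_classical all_reals all_analysis.
From mathcomp Require Import ring lra zify.
Set Implicit Arguments.
Unset Strict Implicit.
Unset Printing Implicit Defensive.
Import Order.TTheory GRing.Theory Num.Theory.
Import numFieldNormedType.Exports.
Import complex.
Local Open Scope classical_set_scope.
Local Open Scope ring_scope.

(** The torus is R/2piZ.  A function or distribution on it is represented by
    the family [u : int -> R[i]] of its Fourier coefficients, so that
    u(x) = \sum_k u_k e^{ikx}. *)

Section complex_prelim.
Context {R : realType}.
Local Notation C := R[i].

Definition cis (x : R) : C := (cos x +i* sin x)%C.

Definition sqnc (z : C) : R := Re z ^+ 2 + Im z ^+ 2.

Lemma sqnc_ge0 z : 0 <= sqnc z.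
Proof. by rewrite addr_ge0 ?sqr_ge0. Qed.

Lemma sqncM (x y : C) : sqnc (x * y) = sqnc x * sqnc y.
Proof. by case: x => a b; case: y => c e; rewrite /sqnc /=; ring. Qed.

Lemma sqnc_cis x : sqnc (cis x) = 1.
Proof. by rewrite /sqnc /= cos2Dsin2. Qed.

Lemma sqnc_real (a : R) : sqnc a%:C%C = a ^+ 2.
Proof. by rewrite /sqnc /= expr0n addr0. Qed.

Lemma sqnc_eq0 z : sqnc z = 0 -> z = 0.
Proof.
case: z => a b /eqP; rewrite /sqnc /= paddr_eq0 ?sqr_ge0// !sqrf_eq0.
by move=> /andP[/eqP -> /eqP ->].
Qed.

(* weighted parallelogram bound; optimising over c is Minkowski's inequality *)
Lemma sqncD_le (c : R) (x y : C) : 0 < c ->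
  sqnc (x + y) <= (1 + c) * sqnc x + (1 + c^-1) * sqnc y.
Proof.
move=> c0; case: x => a b; case: y => e f; rewrite /sqnc /= -subr_ge0.
suff -> : (1 + c) * (a ^+ 2 + b ^+ 2) + (1 + c^-1) * (e ^+ 2 + f ^+ 2)
    - ((a + e) ^+ 2 + (b + f) ^+ 2)
  = c^-1 * ((c * a - e) ^+ 2 + (c * b - f) ^+ 2).
  by rewrite mulr_ge0 ?addr_ge0 ?sqr_ge0// invr_ge0 ltW.
by field; rewrite gt_eqF.
Qed.

(* Unordered (absolutely convergent) sums, as integrals of the positive and
   negative parts against the counting measure. *)
Definition rsum (I : choiceType) (A : set I) (f : I -> R) : R :=
  fine (\esum_(i in A) (Num.max (f i) 0)%:E)
  - fine (\esum_(i in A) (Num.max (- f i) 0)%:E).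

Definition csum (I : choiceType) (A : set I) (f : I -> C) : C :=
  (rsum A (fun i => Re (f i)) +i* rsum A (fun i => Im (f i)))%C.

Definition cintegral (a b : R) (f : R -> C) : C :=
  (Rintegral (@lebesgue_measure R) `[a, b] (fun s => Re (f s))
   +i* Rintegral (@lebesgue_measure R) `[a, b] (fun s => Im (f s)))%C.

Definition fourier (u : int -> C) (x : R) : C :=
  csum setT (fun k : int => u k * cis (k%:~R * x)).

End complex_prelim.

Section sobolev.
Context {R : realType}.
Local Notation C := R[i].
Implicit Types (s : R) (u v : int -> C).

Definition weight s (k : int) : R := (1 + k%:~R ^+ 2) `^ s.

Definition sobolev_sq s u : \bar R :=
  \esum_(k in setT) (weight s k * sqnc (u k))%:E.

Definition in_sobolev s : {pred (int -> C)} :=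
  fun u => `[< (sobolev_sq s u < +oo)%E >].

Lemma weight_gt0 s k : 0 < weight s k.
Proof. by rewrite powR_gt0// ltr_pwDl// sqr_ge0. Qed.

Let term_ge0 s u k : (0 <= (weight s k * sqnc (u k))%:E)%E.
Proof. by rewrite lee_fin mulr_ge0 ?sqnc_ge0// ltW// weight_gt0. Qed.

Lemma sobolev_sq_ge0 s u : (0 <= sobolev_sq s u)%E.
Proof. by apply: esum_ge0 => k _; exact: term_ge0. Qed.

Lemma in_sobolev_fin s u : u \in in_sobolev s -> sobolev_sq s u \is a fin_num.
Proof.
by move=> /asboolP h; rewrite ge0_fin_numE ?sobolev_sq_ge0.
Qed.

Lemma esumZ_le (I : choiceType) (c : R) (f : I -> R) : 0 <= c ->
  (forall i, 0 <= f i) ->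
  (\esum_(i in setT) (c * f i)%:E <= c%:E * \esum_(i in setT) (f i)%:E)%E.
Proof.
move=> c0 f0; apply: ub_ereal_sup => _ [F [finF _] <-].
have -> : (\sum_(i \in F) (c * f i)%:E = c%:E * \sum_(i \in F) (f i)%:E)%E.
  rewrite !fsbig_finite//= ge0_sume_distrr => [|i _]; last by rewrite lee_fin.
  by apply: eq_bigr => i _; rewrite EFinM.
rewrite lee_wpmul2l ?lee_fin//.
by apply: ereal_sup_ubound; exists F.
Qed.

Lemma sobolev_sqZ_le s (c : R) u v : 0 <= c ->
  (forall k, sqnc (u k) <= c * sqnc (v k)) ->
  (sobolev_sq s u <= c%:E * sobolev_sq s v)%E.
Proof.
move=> c0 uv; apply: le_trans (esumZ_le c0 _); last first.
  by move=> k; rewrite mulr_ge0 ?sqnc_ge0// ltW// weight_gt0.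
apply: le_esum => k _; rewrite lee_fin mulrCA ler_wpM2l//.
by rewrite ltW// weight_gt0.
Qed.

Lemma sobolev_sqD_le s (c : R) u v : 0 < c ->
  (sobolev_sq s (u + v)%R
   <= (1 + c)%:E * sobolev_sq s u + (1 + c^-1)%:E * sobolev_sq s v)%E.
Proof.
move=> c0.
have c1 : 0 <= 1 + c by rewrite addr_ge0// ltW.
have c2 : 0 <= 1 + c^-1 by rewrite addr_ge0// invr_ge0 ltW.
have w0 x k : 0 <= weight s k * sqnc (x k).
  by rewrite mulr_ge0 ?sqnc_ge0// ltW// weight_gt0.
apply: le_trans (leeD (esumZ_le c1 (w0 u)) (esumZ_le c2 (w0 v))).
rewrite -esumD; last 2 first.
- by move=> k _; rewrite lee_fin mulr_ge0.
- by move=> k _; rewrite lee_fin mulr_ge0.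
apply: le_esum => k _; rewrite -EFinD lee_fin.
rewrite [X in _ <= X + _]mulrCA [X in _ <= _ + X]mulrCA -mulrDr.
by rewrite ler_wpM2l ?sqncD_le// ltW// weight_gt0.
Qed.

Lemma in_sobolevZ s (c : R) u v : 0 <= c ->
  (forall k, sqnc (u k) <= c * sqnc (v k)) ->
  v \in in_sobolev s -> u \in in_sobolev s.
Proof.
move=> c0 uv vs; apply/asboolP; apply: le_lt_trans (sobolev_sqZ_le s c0 uv) _.
by rewrite -(fineK (in_sobolev_fin vs)) -EFinM ltry.
Qed.

Lemma in_sobolevD s u v :
  u \in in_sobolev s -> v \in in_sobolev s -> u + v \in in_sobolev s.
Proof.
move=> us vs; apply/asboolP.
apply: le_lt_trans (sobolev_sqD_le s u v ltr01) _.
rewrite -(fineK (in_sobolev_fin us)) -(fineK (in_sobolev_fin vs)).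
by rewrite -!EFinM -EFinD ltry.
Qed.

Lemma in_sobolev0 s : 0 \in in_sobolev s.
Proof.
apply/asboolP; rewrite /sobolev_sq esum1 ?ltry// => k _.
by rewrite /sqnc /= expr0n addr0 mulr0.
Qed.

Lemma in_sobolevN s u : u \in in_sobolev s -> - u \in in_sobolev s.
Proof.
apply: (in_sobolevZ ler01) => k; rewrite mul1r.
have -> : (- u) k = - u k by [].
by case: (u k) => a b; rewrite /sqnc /= !sqrrN.
Qed.

Lemma in_sobolev_zmod s : zmod_closed (in_sobolev s).
Proof.
split=> [|u v us vs]; first exact: in_sobolev0.
by apply: in_sobolevD => //; exact: in_sobolevN.
Qed.

HB.instance Definition _ s :=
  GRing.isZmodClosed.Build (int -> C) (in_sobolev s) (in_sobolev_zmod s).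

Record Hs s := MkHs { coef :> int -> C; _ : coef \in in_sobolev s }.

HB.instance Definition _ s := [isSub for @coef s].
HB.instance Definition _ s := [Choice of Hs s by <:].
HB.instance Definition _ s := [SubChoice_isSubZmodule of Hs s by <:].

End sobolev.
Arguments Hs R s : clear implicits.

Section sobolev_normed.
Context {R : realType} (s : R).
Local Notation C := R[i].
Local Notation Hs := (Hs R s).
Implicit Types (u v : Hs) (a b : R).

Lemma coef_in u : coef u \in in_sobolev s.
Proof. by case: u. Qed.

Lemma Hs_eqP u v : (forall k, u k = v k) -> u = v.
Proof. by move=> uv; apply: val_inj; apply/funext. Qed.

Lemma coefD u v k : (u + v) k = u k + v k.
Proof. by []. Qed.

Fact Hs_scale_subproof a u : (fun k => a%:C%C * u k) \in in_sobolev s.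
Proof.
apply: (in_sobolevZ (sqr_ge0 a) _ (coef_in u)) => k.
by rewrite sqncM sqnc_real.
Qed.

Definition Hs_scale a u : Hs := MkHs (Hs_scale_subproof a u).

Fact Hs_scaleA a b u : Hs_scale a (Hs_scale b u) = Hs_scale (a * b) u.
Proof. by apply: Hs_eqP => k /=; rewrite mulrA rmorphM. Qed.

Fact Hs_scale1 : left_id 1 Hs_scale.
Proof. by move=> u; apply: Hs_eqP => k /=; rewrite rmorph1 mul1r. Qed.

Fact Hs_scaleDr : right_distributive Hs_scale +%R.
Proof. by move=> a u v; apply: Hs_eqP => k; exact: mulrDr. Qed.

Fact Hs_scaleDl u : {morph Hs_scale^~ u : a b / a + b}.
Proof. by move=> a b; apply: Hs_eqP => k /=; rewrite rmorphD; exact: mulrDl. Qed.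

HB.instance Definition _ := GRing.Zmodule_isLmodule.Build R Hs
  Hs_scaleA Hs_scale1 Hs_scaleDr Hs_scaleDl.

Lemma coefZ a u k : (a *: u) k = a%:C%C * u k.
Proof. by []. Qed.

Definition Hs_norm u : R := Num.sqrt (fine (sobolev_sq s u)).

Lemma Hs_norm_sq u : (Hs_norm u ^+ 2)%:E = sobolev_sq s u.
Proof.
rewrite sqr_sqrtr ?fine_ge0 ?sobolev_sq_ge0// fineK//.
exact/in_sobolev_fin/coef_in.
Qed.

Lemma Hs_norm0_eq0 u : Hs_norm u = 0 -> u = 0.
Proof.
move=> u0; apply: Hs_eqP => k; have h : sobolev_sq s u = 0%E.
  by rewrite -Hs_norm_sq u0 expr0n.
have : ((weight s k * sqnc (u k))%:E <= 0)%E.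
  rewrite -h; apply: ereal_sup_ubound; exists [set k].
    by split=> //; exact: finite_set1.
  by rewrite fsbig_set1.
rewrite lee_fin pmulr_rle0 ?weight_gt0// => u_le0.
by apply: sqnc_eq0; apply/eqP; rewrite eq_le u_le0 sqnc_ge0.
Qed.

Lemma Hs_norm_ge0 u : 0 <= Hs_norm u.
Proof. exact: sqrtr_ge0. Qed.

Lemma Hs_normZ a u : Hs_norm (a *: u) = `|a| * Hs_norm u.
Proof.
have le c w : Hs_norm (c *: w) <= `|c| * Hs_norm w.
  rewrite -(@ler_pXn2r _ 2)// ?nnegrE ?mulr_ge0 ?Hs_norm_ge0//.
  rewrite exprMn real_normK ?num_real// -lee_fin (EFinM (c ^+ 2)) !Hs_norm_sq.
  by apply: sobolev_sqZ_le => [|k]; rewrite ?sqr_ge0// coefZ sqncM sqnc_real.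
apply/eqP; rewrite eq_le le /=; have [->|a0] := eqVneq a 0.
  by rewrite normr0 mul0r Hs_norm_ge0.
have := le a^-1 (a *: u); rewrite scalerA mulVf// scale1r normfV.
by rewrite mulrC ler_pdivlMr ?normr_gt0// mulrC.
Qed.

Lemma Hs_normD u v : Hs_norm (u + v) <= Hs_norm u + Hs_norm v.
Proof.
have [/Hs_norm0_eq0 ->|nu0] := eqVneq (Hs_norm u) 0.
  by rewrite add0r lerDr Hs_norm_ge0.
have [/Hs_norm0_eq0 ->|nv0] := eqVneq (Hs_norm v) 0.
  by rewrite addr0 lerDl Hs_norm_ge0.
have u0 : 0 < Hs_norm u by rewrite lt_neqAle eq_sym nu0 Hs_norm_ge0.
have v0 : 0 < Hs_norm v by rewrite lt_neqAle eq_sym nv0 Hs_norm_ge0.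
rewrite -(@ler_pXn2r _ 2)// ?nnegrE ?addr_ge0 ?Hs_norm_ge0//.
have c0 : 0 < Hs_norm v / Hs_norm u by rewrite divr_gt0.
have : (sobolev_sq s (coef (u + v)%R) <= _)%E := sobolev_sqD_le s u v c0.
rewrite -!Hs_norm_sq -!EFinM -EFinD lee_fin => /le_trans; apply.
rewrite le_eqVlt; apply/orP; left; apply/eqP; field.
by rewrite nu0 nv0.
Qed.

HB.instance Definition _ :=
  Lmodule_isNormed.Build R Hs Hs_normD Hs_normZ Hs_norm0_eq0.

(* the free Schroedinger group e^{i t \partial_x^2} *)
Fact schrodinger_subproof (t : R) u :
  (fun k : int => cis (- (t * k%:~R ^+ 2)) * u k) \in in_sobolev s.
Proof.
by apply: (in_sobolevZ ler01 _ (coef_in u)) => k; rewrite sqncM sqnc_cis.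
Qed.

Definition schrodinger (t : R) u : Hs := MkHs (schrodinger_subproof t u).

Fact mode_subproof (k : int) :
  (fun j : int => (j == k)%:R : C) \in in_sobolev s.
Proof.
apply/asboolP; rewrite /sobolev_sq.
have -> : \esum_(j in setT) (weight s j * sqnc ((j == k)%:R : C))%:E
        = \esum_(j in [set k]) (weight s k)%:E.
  rewrite [RHS]esum_mkcond; apply: eq_esum => j _.
  have [->|jk] := eqVneq j k.
    by rewrite mem_set// /sqnc /= expr1n expr0n addr0 mulr1.
  rewrite memNset; last exact/eqP.
  by rewrite /sqnc /= expr0n addr0 mulr0.
by rewrite esum_set1 ?ltry// lee_fin ltW// weight_gt0.
Qed.

Definition fourier_mode (k : int) : Hs := MkHs (mode_subproof k).

End sobolev_normed.

Section symplectic.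
Context {R : realType} {s : R}.
Local Notation Hs := (Hs R s).
Implicit Types (f : Hs -> Hs) (O : set Hs).

(* \sum_k du_k /\ d\bar u_k *)
Definition omega (a b : Hs) : R[i] :=
  csum setT (fun k : int => a k * (b k)^*%C - b k * (a k)^*%C).

(* C^1 as a map of real Banach spaces, the derivative being continuous for the
   operator norm *)
Definition C1_on O f := forall u, O u ->
  differentiable f u /\
  forall e : R, 0 < e -> \forall v \near u,
    forall h : Hs, `|'d f v h - 'd f u h| <= e * `|h|.

Definition symplectic_on O f := forall u, O u ->
  differentiable f u /\
  forall a b : Hs, omega ('d f u a) ('d f u b) = omega a b.

End symplectic.

Section noise_operator.
Context {R : realType}.

Definition l2dot (u v : int -> R[i]) : R[i] :=
  csum setT (fun k : int => u k * (v k)^*%C).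

(* Complex linearity and boundedness of A : L^2 -> H^2 follow from
   [fourier_diagonal] and [hilbert_schmidt]. *)
Definition fourier_diagonal (A : Hs R 0 -> Hs R 2) (phi : int -> R[i]) :=
  forall u k, A u k = phi k * u k.

Definition hilbert_schmidt (A : Hs R 0 -> Hs R 2) :=
  (\esum_(k in [set: int]) (`|A (fourier_mode 0 k)| ^+ 2)%:E < +oo)%E.

Definition self_adjoint (A : Hs R 0 -> Hs R 2) :=
  forall u v : Hs R 0, l2dot (A u) v = l2dot u (A v).

End noise_operator.

Section brownian.
Context {R : realType} {dO : measure_display} {Om : measurableType dO}.
Variable P : probability Om R.

Definition brownian (B : R -> Om -> R) : Prop :=
  [/\ forall s, 0 <= s -> measurable_fun setT (B s),
      {ae P, forall x, B 0 x = 0},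
      forall s t (A : set R), 0 <= s < t -> measurable A ->
        P [set x | A (B t x - B s x)] = normal_prob 0 (Num.sqrt (t - s)) A,
      forall (m : nat) (tau : nat -> R) (A : nat -> set R),
        0 <= tau 0%N -> {homo tau : i j / (i <= j)%N >-> i <= j} ->
        (forall i, measurable (A i)) ->
        P [set x | forall i, (i < m)%N -> A i (B (tau i.+1) x - B (tau i) x)]
        = \big[*%E/1%E]_(i < m) P [set x | A i (B (tau i.+1) x - B (tau i) x)]
    & {ae P, forall x, {within `[0, +oo[, continuous (fun s => B s x)}}].

Definition sigma_process (B : R -> Om -> R) : set (set Om) :=
  <<s [set E | exists s (A : set R),
        [/\ 0 <= s, measurable A & E = B s @^-1` A]] >>.

(* Taking [E k = setT] for some of the k gives the product rule for every
   finite subfamily. *)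
Definition independent_processes (B : nat -> R -> Om -> R) :=
  forall (m : nat) (E : nat -> set Om),
    (forall k, sigma_process (B k) (E k)) ->
    P [set x | forall k, (k < m)%N -> E k x]
    = \big[*%E/1%E]_(k < m) P (E k).

Definition driving_noise (W : int -> R -> Om -> R) :=
  [/\ forall k, brownian (W k),
      forall k s x, W (- k) s x = W k s x
    & independent_processes (fun k : nat => W k%:Z)].

(* For deterministic integrands the Stratonovich and the Ito integral are both
   the Wiener integral.  X is the limit in L^2(P) of the integrals against B of
   step functions on [0, b], with value v_i on ]tau_i, tau_{i+1}], as these
   tend to f in L^2([0, b]). *)
Definition is_wiener_integral (B : R -> Om -> R) (b : R) (f : R -> R)
    (X : Om -> R) :=
  measurable_fun setT X /\
  forall e : R, 0 < e -> exists2 delta : R, 0 < delta &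
    forall (m : nat) (tau v : nat -> R),
      tau 0%N = 0 -> tau m = b -> (forall i, (i < m)%N -> tau i <= tau i.+1) ->
      (\sum_(i < m) \int[@lebesgue_measure R]_(s in `[tau i, tau i.+1])
          ((f s - v i) ^+ 2)%:E < delta%:E)%E ->
      ('E_P[fun x => ((X x - \sum_(i < m)
                v i * (B (tau i.+1) x - B (tau i) x)) ^+ 2)%R] < e%:E)%E.

(* The version is chosen once for each integrand, hence for the countably many
   integrands of [Pmap]. *)
Definition wiener_integral (B : R -> Om -> R) (b : R) (f : R -> R) : Om -> R :=
  xget (fun=> 0) [set X | is_wiener_integral B b f X].

Definition cwiener_integral (B : R -> Om -> R) (b : R) (f : R -> R[i])
    (x : Om) : R[i] :=
  (wiener_integral B b (fun s => Re (f s)) x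
   +i* wiener_integral B b (fun s => Im (f s)) x)%C.

End brownian.

Section interpolation.
Context {R : realType}.
Local Notation C := R[i].

(* P_d[f], for the nodes t * gam_j; [interpP] and [interp_unique] show that it
   is the unique polynomial of degree at most d - 1 with these values. *)
Definition interp d (gam : 'I_d -> R) (t : R) (f : R -> C) : {poly C} :=
  xget 0 [set p : {poly C} | (size p <= d)%N /\
            forall j, p.[(t * gam j)%:C%C] = f (t * gam j)].

Lemma interpP d (gam : 'I_d -> R) t f : t != 0 -> injective gam ->
  (size (interp gam t f) <= d)%N /\
  forall j, (interp gam t f).[(t * gam j)%:C%C] = f (t * gam j).
Proof.
move=> t0 gi; rewrite /interp; case: xgetP => [p _ //|none].
exfalso; pose z j : C := (t * gam j)%:C%C.
have zi : injective z by move=> i j /complexI /(mulfI t0) /gi.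
pose l i : {poly C} := \prod_(j < d | j != i) ((z i - z j)^-1 *: ('X - (z j)%:P)).
apply: (none (\sum_i f (t * gam i) *: l i)); split.
  apply: (leq_trans (size_sum _ _ _)); apply/bigmax_leqP => i _.
  apply: (leq_trans (size_scale_leq _ _)).
  apply: (leq_trans (size_poly_prod_leq _ _)).
  have le2 j : j != i -> (size ((z i - z j)^-1 *: ('X - (z j)%:P))%R <= 2)%N.
    by move=> _; apply: (leq_trans (size_scale_leq _ _)); rewrite size_XsubC.
  have cardE : #|[pred j | j != i]| = d.-1 by rewrite cardC1 card_ord.
  rewrite leq_subLR (leq_trans (_ : _ <= (d.-1 * 2).+1)%N)//.
    by rewrite ltnS -cardE -sum_nat_const; exact: leq_sum.
  by rewrite cardE; case: (d) i {l le2 cardE} => [[]//|n _] /=; lia.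
move=> j; rewrite horner_sum (bigD1 j)//= big1 ?addr0 => [|i ij].
  rewrite hornerZ horner_prod big1 ?mulr1// => i ij.
  rewrite hornerZ hornerXsubC mulVf// subr_eq0.
  by apply: contra ij => /eqP /zi ->.
rewrite hornerZ horner_prod (bigD1 j) ?[j == i]eq_sym//=.
by rewrite hornerZ hornerXsubC subrr mulr0 mul0r mulr0.
Qed.

Lemma interp_unique d (gam : 'I_d -> R) t f (p : {poly C}) :
  t != 0 -> injective gam -> (size p <= d)%N ->
  (forall j, p.[(t * gam j)%:C%C] = f (t * gam j)) -> p = interp gam t f.
Proof.
move=> t0 gi sp ep; have [sq eq] := interpP f t0 gi.
apply/eqP; rewrite -subr_eq0; apply/eqP.
apply: (@roots_geq_poly_eq0 _ _ [seq (t * gam j)%:C%C | j <- enum 'I_d]).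
- apply/allP => _ /mapP[j _ ->].
  by rewrite /root hornerD hornerN ep eq subrr.
- by rewrite map_inj_uniq ?enum_uniq// => i j /complexI /(mulfI t0) /gi.
- rewrite size_map size_enum_ord (leq_trans (size_polyD _ _))//.
  by rewrite size_polyN geq_max sp sq.
Qed.

End interpolation.

Section maps.
Context {R : realType}.
Local Notation C := R[i].
Variables (d : nat) (gam : 'I_d -> R) (t : R).

(* s |-> e^{isa} and its interpolant, as functions of the real variable s *)
Definition osc (a : int) (s : R) : C := cis (s * a%:~R).
Definition Posc (a : int) (s : R) : C := (interp gam t (osc a)).[s%:C%C].

Definition kernel2d (s : R) (k k1 k2 k3 : int) : C :=
  osc (- (2 * k * k1)) s * Posc (2 * k2 * k3) s
  + osc (2 * k2 * k3) s * Posc (- (2 * k * k1)) s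
  - Posc (2 * k2 * k3) s * Posc (- (2 * k * k1)) s.

(* k-th Fourier coefficient of F_p^{2d}(t; c; v); j = (k1, k2, k3) *)
Definition Fmap (lam : R) (p : nat) (c : R) (v : int -> C) (k : int) : C :=
  - 'i%C * lam%:C%C *
  csum [set j : int * int * int | k + j.1.1 = j.1.2 + j.2]
    (fun j => ((t ^+ p.+1)^-1)%:C%C
      * cintegral 0 (c * t) (fun s => kernel2d s k j.1.1 j.1.2 j.2 * (s ^+ p)%:C%C)
      * (v j.1.1)^*%C * v j.1.2 * v j.2).

Context {dO : measure_display} {Om : measurableType dO}.
Variable P : probability Om R.

Definition increment (W : int -> R -> Om -> R) (n : nat) (k : int) (s : R)
    (x : Om) : R :=
  W k (n%:R * t + s) x - W k (n%:R * t) x.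

(* k-th Fourier coefficient of P_p^{2d}(t; c; v) for the realisation x of the
   noise B; j = (k1, k2) *)
Definition Pmap (kap : R) (phi : int -> C) (B : int -> R -> Om -> R) (x : Om)
    (p : nat) (c : R) (v : int -> C) (k : int) : C :=
  - 'i%C * kap%:C%C * ((t `^ (p%:R + 2^-1))^-1)%:C%C *
  csum [set j : int * int | k = j.1 + j.2]
    (fun j => v j.1 * phi j.2
      * cwiener_integral P (B j.2) (c * t)
          (fun s => Posc (k * j.2 + j.1 * j.2) s * (s ^+ p)%:C%C) x).

End maps.

(* Re \int_T \bar u F dx *)
Definition mass_rate {R : realType} (u F : int -> R[i]) : R :=
  Rintegral (@lebesgue_measure R) `[0, 2 * pi]
    (fun x => Re ((fourier u x)^*%C * fourier F x)).

Section scheme.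
Context {R : realType} {s : R}.
Local Notation Hs := (Hs R s).

(* the index set D, with (p, q, r) encoded as ((p, q), r) *)
Definition stage (S : nat) : finType := ('I_S.+1 * 'I_S.+1 * 'I_S.+1)%type.

Variables (S : nat) (t : R).
Variables (a : 'I_2 -> stage S -> stage S -> R) (b : 'I_2 -> stage S -> R).
Variables K L : stage S -> Hs -> Hs.

Definition stage_value (al : stage S) (u : Hs) : Hs :=
  u + t *: (\sum_be a ord0 al be *: K be u)
    + Num.sqrt t *: (\sum_be a ord_max al be *: L be u).

Definition stage_equations (c : 'I_S.+1 -> R)
    (F G : nat -> R -> (int -> R[i]) -> int -> R[i]) (u : Hs) :=
  forall al : stage S,
    (forall k, K al u k = F al.1.1 (c al.1.2) (stage_value al u) k) /\
    (forall k, L al u k = G al.1.1 (c al.1.2) (stage_value al u) k).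

Definition rk_step (u : Hs) : Hs :=
  schrodinger t u
  + t *: schrodinger t (\sum_al b ord0 al *: K al u)
  + Num.sqrt t *: schrodinger t (\sum_al b ord_max al *: L al u).

End scheme.

(* Main.v *)
(** The interpolated kernel of the deterministic map is Hermitian under exchange
    of the pairs (k, k1) and (k2, k3), and symmetric in (k, k1): the map is the
    Hamiltonian vector field of a real quartic form.  Likewise the kernel of the
    stochastic map is almost surely Hermitian, because the symbol of the noise
    is real and even, the processes W_k and W_(-k) coincide, and the Wiener
    integral is unique up to null sets, hence odd in its integrand.
    Differentiating the stage equations therefore shows that the stage
    increments are infinitesimally symplectic at the stage values, and the
    algebraic conditions on the coefficients give the invariance of the
    symplectic form exactly as in the classical theorem on quadratic first
    integrals of Runge-Kutta methods.

    For the infinite sums to make sense, s > 1 gives the summable envelope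
    |u_k| <= |u| (1 + k^2)^(-s/2).  Almost sure summability of the stochastic
    kernel against this envelope follows from Tonelli's theorem and a uniform
    bound for the first absolute moments of the Wiener integrals. *)

Require Import Defs.
From HB Require Import structures.
From mathcomp Require Import all_boot all_order all_algebra.
From mathcomp Require Import complex.
From mathcomp Require Import all_classical all_reals all_analysis.
From mathcomp Require Import measurable_realfun ring lra.
Set Implicit Arguments.
Unset Strict Implicit.
Unset Printing Implicit Defensive.
Import Order.TTheory GRing.Theory Num.Theory.
Import numFieldNormedType.Exports.
Local Open Scope classical_set_scope.
Local Open Scope ring_scope.

Local Notation Re := (@complex.Re _).
Local Notation Im := (@complex.Im _).

(** * Absolutely convergent sums *)

(** Probability enters only through two almost sure facts about the countably many noise
    coefficients: their Hermitian symmetry and their summability. This makes the null set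
    independent of [O], [K], [L] and the base point, over which the conclusion quantifies inside;
    past these facts the argument is pathwise. The stage equations are not differentiated as
    equations in H^s. They are tested against a fixed [w] through the symplectic form, so that only
    scalar limits of bounded multilinear forms occur. The uniform moments rest on the interpolation:
    e^{isa} has Lipschitz constant |a|, but its interpolant sees a only through d unimodular values
    and has a Lipschitz constant independent of a. For such integrands summation by parts takes the
    place of the Ito isometry and bounds first moments uniformly in all frequencies, as Tonelli's
    theorem requires. *)

Section absolutely_summable.
Context {R : realType} {I : choiceType}.
Implicit Types f g h : I -> R.

Definition abs_summable f := (\esum_(i in [set: I]) `|f i|%:E < +oo)%E.

Lemma le_abs_summable f g :
  (forall i, `|f i| <= `|g i|) -> abs_summable g -> abs_summable f.
Proof.
move=> fg; apply: le_lt_trans; apply: le_esum => i _.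
by rewrite lee_fin.
Qed.

Lemma abs_summable_norm f : abs_summable f -> abs_summable (fun i => `|f i|).
Proof. by apply: le_abs_summable => i; rewrite normr_id. Qed.

Lemma abs_summableZ (c : R) f :
  abs_summable f -> abs_summable (fun i => c * f i).
Proof.
move=> sf; rewrite /abs_summable.
under eq_esum do rewrite normrM.
apply: le_lt_trans (esumZ_le (normr_ge0 c) (fun i => normr_ge0 (f i))) _.
have : (\esum_(i in [set: I]) `|f i|%:E \is a fin_num)%E.
  by rewrite ge0_fin_numE ?esum_ge0.
by move=> /fineK <-; rewrite -EFinM ltry.
Qed.

Lemma abs_summableD f g :
  abs_summable f -> abs_summable g -> abs_summable (fun i => f i + g i).
Proof.
move=> sf sg; apply: le_lt_trans (lte_add_pinfty sf sg).
rewrite -esumD//; apply: le_esum => i _.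
by rewrite -EFinD lee_fin ler_normD.
Qed.

Lemma abs_summableN f : abs_summable f -> abs_summable (fun i => - f i).
Proof. by apply: le_abs_summable => i; rewrite normrN. Qed.

Lemma ge0_abs_summableP f : (forall i, 0 <= f i) -> abs_summable f ->
  (\esum_(i in [set: I]) (f i)%:E)%E \is a fin_num.
Proof.
move=> f0 sf; rewrite ge0_fin_numE ?esum_ge0// => [|i _]; last by rewrite lee_fin.
by apply: le_lt_trans sf; apply: le_esum => i _; rewrite lee_fin ler_norm.
Qed.

Let pos_summable f : abs_summable f -> abs_summable (fun i => Num.max (f i) 0).
Proof.
apply: le_abs_summable => i; rewrite ger0_norm ?le_max ?lexx ?orbT//.
by rewrite ge_max ler_norm normr_ge0.
Qed.

Let max_sub (x : R) : x = Num.max x 0 - Num.max (- x) 0.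
Proof. by case: (leP x 0) => x0; case: (leP (- x) 0) => x1; lra. Qed.

(** Any decomposition into non-negative summable families can replace the positive and negative
    parts, because p + h = g + m involves no subtraction. Linearity of [rsum] reduces to this. *)
Lemma rsum_sub g h : (forall i, 0 <= g i) -> (forall i, 0 <= h i) ->
  abs_summable g -> abs_summable h ->
  rsum setT (fun i => g i - h i)
  = fine (\esum_(i in [set: I]) (g i)%:E) - fine (\esum_(i in [set: I]) (h i)%:E).
Proof.
move=> g0 h0 sg sh; rewrite /rsum.
set p := fun i => Num.max (g i - h i) 0.
set m := fun i => Num.max (- (g i - h i)) 0.
have sd : abs_summable (fun i => g i - h i) by apply/abs_summableD/abs_summableN.
have sp : abs_summable p by exact: pos_summable.
have sm : abs_summable m by exact/pos_summable/abs_summableN.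
have p0 i : 0 <= p i by rewrite le_max lexx orbT.
have m0 i : 0 <= m i by rewrite le_max lexx orbT.
have E : (\esum_(i in [set: I]) (p i)%:E + \esum_(i in [set: I]) (h i)%:E
    = \esum_(i in [set: I]) (g i)%:E + \esum_(i in [set: I]) (m i)%:E)%E.
  rewrite -!esumD; try by move=> i _; rewrite lee_fin.
  apply: eq_esum => i _; rewrite -!EFinD; congr EFin.
  by move: (max_sub (g i - h i)); rewrite /p /m; lra.
have /(congr1 fine) := E.
by rewrite !fineD ?ge0_abs_summableP//; lra.
Qed.

Lemma ge0_rsum f : (forall i, 0 <= f i) -> abs_summable f ->
  rsum setT f = fine (\esum_(i in [set: I]) (f i)%:E).
Proof.
move=> f0 sf; have s0 : abs_summable (fun=> 0 : R).
  by rewrite /abs_summable esum1 ?ltry// => i _; rewrite normr0.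
rewrite -[LHS]/(rsum _ (fun i => f i)).
under eq_fun do rewrite -[f _]subr0.
by rewrite rsum_sub// [X in _ - fine X]esum1// subr0.
Qed.

Lemma rsum_posneg f : abs_summable f -> exists g h,
  [/\ (forall i, 0 <= g i), (forall i, 0 <= h i), abs_summable g,
      abs_summable h & forall i, f i = g i - h i].
Proof.
move=> sf; exists (fun i => Num.max (f i) 0), (fun i => Num.max (- f i) 0).
split=> // [i|i||]; rewrite ?le_max ?lexx ?orbT//.
- exact: pos_summable.
- exact/pos_summable/abs_summableN.
Qed.

Lemma rsumD f g : abs_summable f -> abs_summable g ->
  rsum setT (fun i => f i + g i) = rsum setT f + rsum setT g.
Proof.
move=> /rsum_posneg[f1 [f2 [f10 f20 sf1 sf2 fE]]].
move=> /rsum_posneg[g1 [g2 [g10 g20 sg1 sg2 gE]]].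
have -> : f = fun i => f1 i - f2 i by apply/funext.
have -> : g = fun i => g1 i - g2 i by apply/funext.
have -> : (fun i => f1 i - f2 i + (g1 i - g2 i))
        = (fun i => (f1 i + g1 i) - (f2 i + g2 i)).
  by apply/funext => i; ring.
rewrite !rsum_sub//; first last.
- exact: abs_summableD.
- exact: abs_summableD.
- by move=> i; rewrite addr_ge0.
- by move=> i; rewrite addr_ge0.
under eq_esum do rewrite EFinD.
under [X in _ - fine X]eq_esum do rewrite EFinD.
rewrite !esumD; try by move=> i _; rewrite lee_fin.
by rewrite !fineD ?ge0_abs_summableP//; ring.
Qed.

Lemma rsumN f : rsum setT (fun i => - f i) = - rsum setT f.
Proof.
by rewrite /rsum; under [X in _ - fine X]eq_esum do rewrite opprK; rewrite opprB.
Qed.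

Lemma rsum0 : rsum [set: I] (fun=> 0 : R) = 0.
Proof. by have := rsumN (fun=> 0 : R); under eq_fun do rewrite oppr0; lra. Qed.

Lemma rsumZ (c : R) f : abs_summable f ->
  rsum setT (fun i => c * f i) = c * rsum setT f.
Proof.
suff pos (d : R) g : 0 <= d -> abs_summable g ->
    rsum setT (fun i => d * g i) = d * rsum setT g.
  move=> sf; have [c0|c0] := leP 0 c; first exact: pos.
  rewrite -[c]opprK; under eq_fun do rewrite mulNr; rewrite rsumN pos ?mulNr//.
  by rewrite oppr_ge0 ltW.
move=> d0 sg; have [->|dN0] := eqVneq d 0.
  by under eq_fun do rewrite mul0r; rewrite rsum0 mul0r.
have dp : 0 < d by rewrite lt_neqAle eq_sym dN0.
have scale h : (forall i, 0 <= h i) -> abs_summable h ->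
    fine (\esum_(i in [set: I]) (d * h i)%:E)
    = d * fine (\esum_(i in [set: I]) (h i)%:E).
  move=> h0 sh.
  have F : (\esum_(i in [set: I]) (d * h i)%:E
            = d%:E * \esum_(i in [set: I]) (h i)%:E)%E.
    apply/eqP; rewrite eq_le esumZ_le//=.
    (* [esumZ_le] is one-sided; applied with [d^-1] to the scaled family it yields the converse
       bound. *)
    have := @esumZ_le _ I d^-1 (fun i => d * h i).
    under eq_esum do rewrite mulKf//.
    rewrite invr_ge0 => /(_ d0 (fun i => mulr_ge0 d0 (h0 i))) le.
    by rewrite muleC -lee_pdivlMr// muleC.
  by rewrite F fineM// ge0_abs_summableP.
have [g1 [g2 [g10 g20 sg1 sg2 gE]]] := rsum_posneg sg.
have -> : g = fun i => g1 i - g2 i by apply/funext.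
under eq_fun do rewrite mulrBr.
rewrite !rsum_sub// ?scale ?mulrBr//; try exact: abs_summableZ.
- by move=> i; rewrite mulr_ge0.
- by move=> i; rewrite mulr_ge0.
Qed.

Lemma norm_rsum_le f : abs_summable f ->
  `|rsum setT f| <= fine (\esum_(i in [set: I]) `|f i|%:E).
Proof.
move=> sf; have sn := abs_summable_norm sf.
have le g : abs_summable g -> (forall i, `|g i| = `|f i|) ->
    rsum setT g <= fine (\esum_(i in [set: I]) `|f i|%:E).
  move=> sg gf; rewrite /rsum lerBlDr.
  apply: (@le_trans _ _ (fine (\esum_(i in [set: I]) `|f i|%:E))).
    apply: fine_le; rewrite ?ge0_abs_summableP//.
    - by move=> i; rewrite le_max lexx orbT.
    - exact: pos_summable.
    - apply: le_esum => i _; rewrite lee_fin -gf ge_max ler_norm.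
      exact: normr_ge0.
  rewrite lerDl fine_ge0// esum_ge0// => i _.
  by rewrite lee_fin le_max lexx orbT.
rewrite ler_norml le// andbT lerNl -rsumN; apply: le => [|i].
  exact: abs_summableN.
by rewrite normrN.
Qed.

End absolutely_summable.

(** * Reindexing and Fubini for unordered sums *)

Section summation_theorems.
Context {R : realType} {I J : choiceType}.

Lemma rsum_reindex (e : I -> J) (f : J -> R) : bijective e ->
  rsum setT f = rsum setT (f \o e).
Proof.
rewrite -setTT_bijective => eb; rewrite /rsum.
by congr (fine _ - fine _); exact: reindex_esum.
Qed.

Lemma esum_pair (f : I -> J -> \bar R) : (forall i j, (0 <= f i j)%E) ->
  (\esum_(i in [set: I]) \esum_(j in [set: J]) f i j
   = \esum_(p in [set: I * J]) f p.1 p.2)%E.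
Proof. by move=> f0; rewrite esum_esum//; congr esum; apply/seteqP; split. Qed.

Lemma abs_summable_pair1 (f : I -> J -> R) i :
  abs_summable (fun p => f p.1 p.2) -> abs_summable (f i).
Proof.
rewrite /abs_summable -(@esum_pair (fun i j => `|f i j|%:E)) //.
apply: le_lt_trans; apply: esum_ge; exists [set i].
  by split=> //; exact: finite_set1.
by rewrite fsbig_set1.
Qed.

Lemma abs_summable_pair2 (f : I -> J -> R) :
  abs_summable (fun p => f p.1 p.2) -> abs_summable (fun i => rsum setT (f i)).
Proof.
move=> sf; have := sf; rewrite /abs_summable.
rewrite -(@esum_pair (fun i j => `|f i j|%:E))//.
apply: le_lt_trans; apply: le_esum => i _.
have si := abs_summable_pair1 i sf.
apply: (@le_trans _ _ (fine (\esum_(j in [set: J]) `|f i j|%:E))%:E).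
  by rewrite lee_fin norm_rsum_le.
by rewrite fineK// ge0_abs_summableP// abs_summable_norm.
Qed.

(** Tonelli's theorem settles the non-negative case. The splitting into parts is made on the product
    index set, so that every section of both parts is summable. *)
Lemma rsum_pair (f : I -> J -> R) : abs_summable (fun p => f p.1 p.2) ->
  rsum setT (fun i => rsum setT (f i)) = rsum setT (fun p => f p.1 p.2).
Proof.
suff pos (g : I -> J -> R) : (forall i j, 0 <= g i j) ->
    abs_summable (fun p => g p.1 p.2) ->
    rsum setT (fun i => rsum setT (g i)) = rsum setT (fun p => g p.1 p.2).
  move=> /[dup] sf /rsum_posneg[g [h [g0 h0 sg sh fE]]].
  pose g' i j := g (i, j); pose h' i j := h (i, j).
  have sg' : abs_summable (fun p => g' p.1 p.2).
    by rewrite (_ : (fun p => _) = g)//; apply/funext => -[].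
  have sh' : abs_summable (fun p => h' p.1 p.2).
    by rewrite (_ : (fun p => _) = h)//; apply/funext => -[].
  have E1 : (fun i => rsum setT (f i))
      = fun i => rsum setT (g' i) + - rsum setT (h' i).
    apply/funext => i; rewrite -rsumN -rsumD.
    - by congr rsum; apply/funext => j; rewrite (fE (i, j)).
    - exact: abs_summable_pair1 sg'.
    - exact/abs_summableN/(abs_summable_pair1 _ sh').
  have E2 : (fun p => f p.1 p.2) = fun p => g' p.1 p.2 + - h' p.1 p.2.
    by apply/funext => -[i j]; rewrite (fE (i, j)).
  have [sg2 sh2] := (abs_summable_pair2 sg', abs_summable_pair2 sh').
  have [g0' h0'] : (forall i j, 0 <= g' i j) /\ (forall i j, 0 <= h' i j).
    by split=> i j; [exact: g0|exact: h0].
  rewrite E1 (rsumD sg2 (abs_summableN sh2)) rsumN (pos _ g0' sg').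
  by rewrite (pos _ h0' sh') E2 (rsumD sg' (abs_summableN sh')) rsumN.
move=> g0 sg; have E i : (rsum setT (g i))%:E = (\esum_(j in [set: J]) (g i j)%:E)%E.
  rewrite ge0_rsum ?fineK ?ge0_abs_summableP//; exact: abs_summable_pair1 sg.
rewrite !ge0_rsum//; last 2 first.
- by move=> i; rewrite -lee_fin E esum_ge0// => j _; rewrite lee_fin.
- exact: abs_summable_pair2.
under eq_esum do rewrite E.
by rewrite (@esum_pair (fun i j => (g i j)%:E))// => i j; rewrite lee_fin.
Qed.

End summation_theorems.

(** The summation sets of [Fmap] and [Pmap] depend on k; an indicator inside the summand makes
    Fubini over a product type applicable. *)
Lemma rsum_mkcond {R : realType} {I : choiceType} (A : set I) (f : I -> R) :
  rsum A f = rsum setT (fun i => if i \in A then f i else 0).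
Proof.
rewrite /rsum [X in fine X - _]esum_mkcond [X in _ - fine X]esum_mkcond.
congr (fine _ - fine _); apply: eq_esum => i _; case: ifP => //.
- by rewrite maxxx.
- by rewrite oppr0 maxxx.
Qed.

(** * Decay of Fourier coefficients *)

Section complex_modulus.
Context {R : realType}.
Implicit Types z w : R[i].

(** A modulus with values in [R], since the norm of [R[i]] takes its values in [R[i]]. *)
Definition cabs z : R := Num.sqrt (sqnc z).

Lemma cabs_ge0 z : 0 <= cabs z. Proof. exact: sqrtr_ge0. Qed.

Lemma cabsM z w : cabs (z * w) = cabs z * cabs w.
Proof. by rewrite /cabs sqncM sqrtrM// sqnc_ge0. Qed.

Lemma cabs_sq z : cabs z ^+ 2 = sqnc z.
Proof. by rewrite sqr_sqrtr// sqnc_ge0. Qed.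

Lemma normr_Re_le z : `|Re z| <= cabs z.
Proof. by rewrite -sqrtr_sqr ler_sqrt ?sqnc_ge0// /sqnc lerDl sqr_ge0. Qed.

Lemma normr_Im_le z : `|Im z| <= cabs z.
Proof. by rewrite -sqrtr_sqr ler_sqrt ?sqnc_ge0// /sqnc lerDr sqr_ge0. Qed.

Lemma cabs_le z : cabs z <= `|Re z| + `|Im z|.
Proof.
rewrite -(@ler_pXn2r _ 2)// ?nnegrE ?cabs_ge0 ?addr_ge0// cabs_sq /sqnc.
rewrite sqrrD !real_normK ?num_real// lerD2r lerDl mulrn_wge0//.
Qed.

Lemma cabs_conj z : cabs (z^*)%C = cabs z.
Proof. by case: z => a b; rewrite /cabs /sqnc /= sqrrN. Qed.

Lemma cabs_cis x : cabs (cis x : R[i]) = 1.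
Proof. by rewrite /cabs sqnc_cis sqrtr1. Qed.

Lemma cabs_real (x : R) : cabs x%:C%C = `|x|.
Proof. by rewrite /cabs sqnc_real sqrtr_sqr. Qed.

End complex_modulus.

Section sobolev_decay.
Context {R : realType} (s : R).

Definition decay (k : int) : R := (1 + k%:~R ^+ 2) `^ (- (s / 2)).

Lemma decay_gt0 k : 0 < decay k.
Proof. by rewrite powR_gt0// ltr_pwDl// sqr_ge0. Qed.

Lemma decay_ge0 k : 0 <= decay k. Proof. exact/ltW/decay_gt0. Qed.

Lemma decay_le1 k : 0 <= s -> decay k <= 1.
Proof.
move=> s0; have b1 : 1 <= 1 + k%:~R ^+ 2 :> R by rewrite lerDl sqr_ge0.
rewrite -(powRr0 (1 + k%:~R ^+ 2 : R)) ler_powR// oppr_le0.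
by rewrite divr_ge0.
Qed.

Lemma decay_sq_weight k : decay k ^+ 2 * weight s k = 1.
Proof.
have b0 : 0 < 1 + k%:~R ^+ 2 :> R by rewrite ltr_pwDl// sqr_ge0.
rewrite expr2 -!powRD ?(lt0r_neq0 b0) ?implybT//.
by rewrite (_ : _ + _ + _ = 0) ?powRr0//; field.
Qed.

Lemma cabs_coef_le (u : Hs R s) k : cabs (u k) <= `|u| * decay k.
Proof.
rewrite -[`|u|]/(Hs_norm u) -(@ler_pXn2r _ 2)//
  ?nnegrE ?mulr_ge0 ?decay_ge0 ?cabs_ge0 ?Hs_norm_ge0//.
have w0 := weight_gt0 s k.
rewrite cabs_sq exprMn -(ler_pM2l w0) mulrCA [X in _ <= _ * X]mulrC.
rewrite decay_sq_weight mulr1 -lee_fin Hs_norm_sq; apply: esum_ge.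
exists [set k]; first by split=> //; exact: finite_set1.
by rewrite fsbig_set1.
Qed.

End sobolev_decay.

Section decay_summable.
Context {R : realType} (s : R) (s1 : 1 < s).

(** The comparison series telescopes: the differences of (n + 1)^(-eta) sum to at most 1 and
    dominate eta (n + 2)^(-s). *)
Let eta := s - 1.
Let eta0 : 0 < eta. Proof. by rewrite subr_gt0. Qed.
Let b (n : nat) : R := n.+1%:R `^ (- eta).
Let dif (n : nat) : R := b n - b n.+1.

(* Bernoulli: (1 - 1/m)^-eta >= 1 + eta / m, with m = n + 2 *)
Let dif_ge n : eta * n.+2%:R `^ (- s) <= dif n.
Proof.
have m0 : 0 < n.+2%:R :> R by rewrite ltr0n.
have m1 : 0 < n.+1%:R :> R by rewrite ltr0n.
have E : n.+1%:R = n.+2%:R * (1 - n.+2%:R^-1) :> R.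
  by rewrite mulrBr mulfV ?gt_eqF// mulr1 -[n.+2]addn1 natrD addrK.
have q0 : 0 < 1 - n.+2%:R^-1 :> R.
  by rewrite subr_gt0 invf_lt1// ltr1n.
rewrite /dif /b E powRM ?(ltW m0) ?(ltW q0)// -[X in _ - X]mulr1 -mulrBr.
have -> : - s = - eta - 1 by rewrite /eta; ring.
rewrite powRB ?(lt0r_neq0 m0) ?implybT// powRr1 ?(ltW m0)// mulrCA ler_wpM2l ?powR_ge0//.
rewrite lerBrDr /powR gt_eqF//.
apply: le_trans (expR_ge1Dx _); rewrite addrC lerD2l mulNr -mulrN.
rewrite ler_wpM2l ?(ltW eta0)// lerNr.
by apply: le_trans (le_ln1Dx _) _ => //; rewrite ltrN2 invf_lt1// ltr1n.
Qed.

Let dif_ge0 n : 0 <= dif n.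
Proof. by apply: le_trans (dif_ge n); rewrite mulr_ge0 ?powR_ge0// ltW. Qed.

Let esum_dif : (\esum_(n in [set: nat]) (dif n)%:E <= 1%:E)%E.
Proof.
rewrite -nneseries_esumT => [|n]; last by rewrite lee_fin.
apply: lime_le; first by apply: is_cvg_nneseries => n _ _; rewrite lee_fin.
apply: nearW => n; rewrite sumEFin lee_fin.
have -> : \sum_(0 <= i < n) dif i = b 0 - b n.
  rewrite -[RHS]opprB -telescope_sumr// -sumrN.
  by apply: eq_bigr => i _; rewrite opprB.
by rewrite /b powR1 lerBlDr lerDl powR_ge0.
Qed.

(** The 5 comes from (n + 2)^2 <= 5 (1 + n^2), that is (2n - 1)^2 >= 0; raised to the power s / 2 it
    compares [decay] with (n + 2)^(-s). *)
Let C := 5 `^ (s / 2) / eta.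
Let C0 : 0 <= C. Proof. by rewrite divr_ge0 ?powR_ge0// ltW. Qed.

(** The inequality in the hypothesis covers both halves of the integers at once: |k| is n for
    [Posz n] and n + 1 for [Negz n]. *)
Let decay_dif (k : int) (n : nat) : (n <= `|k|)%N -> decay s k <= C * dif n.
Proof.
move=> nk; apply: le_trans (ler_wpM2l C0 (dif_ge n)).
rewrite /C mulrA mulfVK ?gt_eqF// /decay.
have k0 : 0 < 1 + k%:~R ^+ 2 :> R by rewrite ltr_pwDl// sqr_ge0.
have m0 : 0 < n.+2%:R :> R by rewrite ltr0n.
have Y : n.+2%:R ^+ 2 <= 5 * (1 + k%:~R ^+ 2) :> R.
  have : n%:R ^+ 2 <= k%:~R ^+ 2 :> R.
    rewrite -[k%:~R ^+ 2]real_normK ?num_real// -intr_norm -abszE.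
    by rewrite ler_pXn2r ?nnegrE// ler_nat.
  have -> : n.+2%:R = n%:R + 2 :> R by rewrite -natrD addn2.
  set x := n%:R; set y := k%:~R ^+ 2 => xy.
  have : 0 <= (2 * x - 1) ^+ 2 by rewrite sqr_ge0.
  by move: xy; rewrite !expr2; lra.
have le : n.+2%:R `^ s <= 5 `^ (s / 2) * (1 + k%:~R ^+ 2) `^ (s / 2).
  rewrite -powRM ?(ltW k0)// [X in _ `^ X <= _](_ : s = 2%:R * (s / 2)).
    rewrite powRrM powR_mulrn ?(ltW m0)//.
    have s0 : 0 <= s / 2 by rewrite divr_ge0// ltW// (lt_trans ltr01).
    by apply: (ge0_ler_powR s0) Y; rewrite nnegrE ?mulr_ge0 ?(ltW k0) ?exprn_ge0.
  by field.
rewrite !powRN ler_pdivlMr ?powR_gt0// [leLHS]mulrC ler_pdivrMr ?powR_gt0//.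
Qed.

Lemma decay_summable : abs_summable (decay s).
Proof.
have -> : decay s = fun k => C * (C^-1 * decay s k).
  apply/funext => k; rewrite mulVKf// gt_eqF// divr_gt0 ?powR_gt0//.
apply: abs_summableZ.
rewrite /abs_summable (esumID (range Posz))// !setTI.
have -> : ~` range Posz = range Negz.
  apply/seteqP; split=> [[n|n] h|_ [n _ <-] [m]] //.
  by case: h; exists n.
have C1 : 0 < C by rewrite divr_gt0 ?powR_gt0.
have le (e : nat -> int) : injective e -> (forall n, (n <= `|e n|)%N) ->
    (\esum_(k in range e) `|C^-1 * decay s k|%:E <= 1%:E)%E.
  move=> ei en; rewrite esum_image; last by move=> x y _ _; exact: ei.
  apply: le_trans esum_dif; apply: le_esum => n _; rewrite lee_fin.
  rewrite ger0_norm ?mulr_ge0 ?invr_ge0 ?decay_ge0//.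
  by rewrite ler_pdivrMl// decay_dif.
apply: le_lt_trans (leeD (le Posz _ _) (le Negz _ _)) _ => //.
- by move=> m n [].
- by move=> m n [].
- by rewrite -EFinD ltry.
Qed.

End decay_summable.

(** * The symplectic form and pairings of Fourier series *)

Lemma abs_summable_dom {R : realType} {I : choiceType} (c : R) (f g : I -> R) :
  (forall i, `|f i| <= c * g i) -> abs_summable g -> abs_summable f.
Proof.
move=> fg /(abs_summableZ c); apply: le_abs_summable => i.
exact: le_trans (fg i) (ler_norm _).
Qed.

Lemma norm_rsum_dom {R : realType} {I : choiceType} (c : R) (f g : I -> R) :
  (forall i, 0 <= g i) -> (forall i, `|f i| <= c * g i) -> abs_summable g ->
  `|rsum setT f| <= c * rsum setT g.
Proof.
move=> g0 fg sg; have sf := abs_summable_dom fg sg.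
apply: le_trans (norm_rsum_le sf) _; rewrite -rsumZ//.
have cg0 i : 0 <= c * g i by apply: le_trans (fg i).
rewrite ge0_rsum//; last exact: abs_summableZ.
apply: fine_le.
- exact/(ge0_abs_summableP (fun i => normr_ge0 (f i)))/abs_summable_norm.
- exact/(ge0_abs_summableP cg0)/abs_summableZ.
- by apply: le_esum => i _; rewrite lee_fin.
Qed.

Lemma eq_ReIm {R : realType} (z w : R[i]) : Re z = Re w -> Im z = Im w -> z = w.
Proof. by case: z => ? ?; case: w => ? ? /= -> ->. Qed.

Section symplectic_form.
Context {R : realType} {s : R}.
Hypothesis s1 : 1 < s.
Local Notation Hs := (Hs R s).
Implicit Types a b : Hs.

(** Each term of [omega] is 2i times this imaginary part, so a real bilinear form carries all the
    information; see [omegaE]. *)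
Definition sform a b : R := rsum setT (fun k : int => Im (a k * (b k)^*%C)).

Let s0 : 0 <= s. Proof. exact/ltW/lt_trans/s1. Qed.

Lemma sform_term_le a b k :
  `|Im (a k * (b k)^*%C)| <= `|a| * `|b| * decay s k.
Proof.
apply: le_trans (normr_Im_le _) _; rewrite cabsM cabs_conj.
apply: le_trans (ler_pM (cabs_ge0 _) (cabs_ge0 _) (cabs_coef_le a k)
  (cabs_coef_le b k)) _.
rewrite mulrACA ler_wpM2l ?mulr_ge0//.
by rewrite -[leRHS]mulr1 ler_wpM2l ?decay_ge0// decay_le1.
Qed.

Let term_summable a b : abs_summable (fun k : int => Im (a k * (b k)^*%C)).
Proof.
exact: (abs_summable_dom (sform_term_le a b) (decay_summable s1)).
Qed.

Lemma sform_le a b : `|sform a b| <= rsum setT (decay s) * (`|a| * `|b|).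
Proof.
rewrite mulrC; apply: norm_rsum_dom (sform_term_le a b) (decay_summable s1).
by move=> k; exact: decay_ge0.
Qed.

Lemma sformC a b : sform a b = - sform b a.
Proof.
rewrite -rsumN; congr rsum; apply/funext => k.
by case: (a k) => x y; case: (b k) => z w /=; ring.
Qed.

Lemma sformDl a a' b : sform (a + a') b = sform a b + sform a' b.
Proof.
rewrite -rsumD//; congr rsum; apply/funext => k.
by rewrite Defs.coefD; case: (a k); case: (a' k); case: (b k) => * /=; ring.
Qed.

Lemma sformDr a b b' : sform a (b + b') = sform a b + sform a b'.
Proof. by rewrite sformC sformDl opprD -!sformC. Qed.

Lemma sformZl (c : R) a b : sform (c *: a) b = c * sform a b.
Proof.
rewrite -rsumZ//; congr rsum; apply/funext => k.
by rewrite Defs.coefZ; case: (a k); case: (b k) => * /=; ring.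
Qed.

Lemma sformZr (c : R) a b : sform a (c *: b) = c * sform a b.
Proof. by rewrite sformC sformZl -mulrN -sformC. Qed.

Lemma sform_schrodinger (t : R) a b :
  sform (schrodinger t a) (schrodinger t b) = sform a b.
Proof.
congr rsum; apply/funext => k /=.
have := cos2Dsin2 (- (t * k%:~R ^+ 2) : R); rewrite /cis.
set x := cos _; set y := sin _.
case: (a k) => a1 a2; case: (b k) => b1 b2 /= xy.
by rewrite -[RHS]mul1r -xy; ring.
Qed.

Lemma omegaE a b : omega a b = (0 +i* (2 * sform a b))%C.
Proof.
rewrite /omega /csum; congr Complex.
  rewrite -[RHS](@rsum0 R int); congr rsum; apply/funext => k.
  by case: (a k); case: (b k) => * /=; ring.
rewrite -rsumZ//; congr rsum; apply/funext => k.
by case: (a k); case: (b k) => * /=; ring.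
Qed.

End symplectic_form.

(** * Pairings of double sums with a test vector *)

Section pairing.
Context {R : realType} {s : R} {J : choiceType} (A : int -> set J).
Local Notation C := R[i].
Local Notation Hs := (Hs R s).
Implicit Types (f : int -> J -> C) (w : Hs) (g : int -> J -> R).

(** The constraint on j is an indicator in the summand, so that the sum runs over all of [int * J]
    and can be reindexed by any bijection of that type. *)
Definition pairing_term f w (p : int * J) : R :=
  if p.2 \in A p.1 then Re (f p.1 p.2 * (w p.1)^*%C) else 0.

(* Re \sum_k \bar w_k \sum_{j in A k} f k j *)
Definition pairing f w : R := rsum setT (pairing_term f w).

Lemma eq_pairing f1 f2 w : (forall k j, f1 k j = f2 k j) ->
  pairing f1 w = pairing f2 w.
Proof.
move=> f12; rewrite /pairing; congr rsum; apply/funext => p.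
by rewrite /pairing_term f12.
Qed.

Definition pairing_weight g (p : int * J) : R :=
  if p.2 \in A p.1 then g p.1 p.2 * decay s p.1 else 0.

Definition dominated f (c : R) g :=
  forall k j, A k j -> cabs (f k j) <= c * g k j.

Variable g : int -> J -> R.
Hypothesis g0 : forall k j, 0 <= g k j.
Hypothesis g_summable : abs_summable (pairing_weight g).

Lemma pairing_term_le f w c p : dominated f c g ->
  `|pairing_term f w p| <= c * `|w| * pairing_weight g p.
Proof.
move=> fg; rewrite /pairing_term /pairing_weight; case: ifPn; last first.
  by rewrite mulr0 normr0.
rewrite inE => pA; apply: le_trans (normr_Re_le _) _; rewrite cabsM cabs_conj.
apply: le_trans (ler_pM (cabs_ge0 _) (cabs_ge0 _) (fg _ _ pA)
  (cabs_coef_le w _)) _.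
by rewrite mulrACA.
Qed.

Lemma pairing_summable f w c : dominated f c g ->
  abs_summable (pairing_term f w).
Proof.
move=> fg; exact: (abs_summable_dom (fun p => pairing_term_le w p fg)).
Qed.

Lemma pairing_le f w c : dominated f c g ->
  `|pairing f w| <= c * `|w| * rsum setT (pairing_weight g).
Proof.
move=> fg; apply: norm_rsum_dom (fun p => pairing_term_le w p fg) g_summable.
by move=> p; rewrite /pairing_weight; case: ifP => // _; rewrite mulr_ge0 ?decay_ge0.
Qed.

Lemma pairingDl f1 f2 c1 c2 w : dominated f1 c1 g -> dominated f2 c2 g ->
  pairing (fun k j => f1 k j + f2 k j) w = pairing f1 w + pairing f2 w.
Proof.
move=> d1 d2.
rewrite -(rsumD (pairing_summable w d1) (pairing_summable w d2)).
congr rsum; apply/funext => p; rewrite /pairing_term.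
case: ifP => _; rewrite ?addr0//.
by case: (f1 _ _); case: (f2 _ _); case: (w _) => * /=; ring.
Qed.

Lemma pairingZl f c (x : R) w : dominated f c g ->
  pairing (fun k j => x%:C%C * f k j) w = x * pairing f w.
Proof.
move=> d; rewrite -(rsumZ _ (pairing_summable w d)).
congr rsum; apply/funext => p; rewrite /pairing_term.
case: ifP => _; rewrite ?mulr0//.
by case: (f _ _); case: (w _) => * /=; ring.
Qed.

(** The identity Im (-i z) = - Re z turns the symplectic form into the real pairing, and Fubini
    merges the outer sum over k with the inner one over j. *)
Lemma sform_pairing f c (x : R) (K w : Hs) : dominated f c g ->
  (forall k, K k = - 'i%C * x%:C%C * csum (A k) (f k)) ->
  sform K w = - x * pairing f w.
Proof.
move=> d KE; rewrite /pairing -(rsumZ _ (pairing_summable w d)).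
have gs k : abs_summable (fun j => pairing_weight g (k, j)).
  by apply: (@abs_summable_pair1 _ _ _ (fun k j => pairing_weight g (k, j)));
    rewrite (_ : (fun p => _) = pairing_weight g)//; apply/funext => -[].
(* At fixed k the factor [decay s k] is a positive constant and can be divided out of the summable
   weight; this gives convergence of the inner sum. *)
have Fs (h : C -> R) k : (forall z, `|h z| <= cabs z) ->
    abs_summable (fun j => if j \in A k then h (f k j) else 0).
  move=> hz; apply: (abs_summable_dom (c := c * (decay s k)^-1) _ (gs k)) => j.
  rewrite /pairing_weight /=; case: ifPn => [|_]; last by rewrite mulr0 normr0.
  rewrite inE => Aj; apply: le_trans (hz _) _; apply: le_trans (d _ _ Aj) _.
  by rewrite mulrAC -mulrA mulfK ?gt_eqF ?decay_gt0// mulrC.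
have E k : Im (K k * (w k)^*%C) = - x * rsum setT (fun j => pairing_term f w (k, j)).
  have Rs := Fs Re k normr_Re_le; have Is := Fs Im k normr_Im_le.
  rewrite KE /csum !(rsum_mkcond (A k)).
  have -> : (fun j => pairing_term f w (k, j)) = fun j =>
      Re (w k) * (if j \in A k then Re (f k j) else 0)
      + Im (w k) * (if j \in A k then Im (f k j) else 0).
    apply/funext => j; rewrite /pairing_term /=; case: ifP => _; last by ring.
    by case: (f k j); case: (w k) => * /=; ring.
  rewrite (rsumD (abs_summableZ _ Rs) (abs_summableZ _ Is)) !rsumZ//.
  by case: (w k) => * /=; ring.
rewrite /sform; under eq_fun do rewrite E.
have ps := pairing_summable w d.
rewrite -(@rsum_pair _ _ _ (fun k j => - x * pairing_term f w (k, j))).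
  congr rsum; apply/funext => k; rewrite rsumZ//.
  apply: (@abs_summable_pair1 _ _ _ (fun k j => pairing_term f w (k, j))).
  by rewrite (_ : (fun p => _) = pairing_term f w)//; apply/funext => -[].
rewrite (_ : (fun p => _) = fun p => - x * pairing_term f w p).
  exact: abs_summableZ.
by apply/funext => -[].
Qed.

End pairing.

(** * Directional derivatives and Runge-Kutta invariance *)

Section directional_limits.
Context {R : realType} {V : normedModType R}.
Implicit Types (l : V -> R) (T : V -> V -> V -> R).

Definition linear_functional l :=
  (forall x y, l (x + y) = l x + l y) /\ (forall a x, l (a *: x) = a * l x).

Definition bounded_functional l :=
  linear_functional l /\ exists c : R, forall x, `|l x| <= c * `|x|.

Definition bounded_trilinear T :=
  [/\ forall y z, linear_functional (fun x => T x y z),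
      forall x z, linear_functional (fun y => T x y z),
      forall x y, linear_functional (T x y)
    & exists c : R, forall x y z, `|T x y z| <= c * `|x| * `|y| * `|z|].

Lemma linear_functionalB l x y : linear_functional l -> l (x - y) = l x - l y.
Proof. by move=> [lD lZ]; rewrite lD -scaleN1r lZ mulN1r. Qed.

Lemma bounded_functional_cvg I (F : set_system I) {FF : Filter F} l
    (X : I -> V) x : bounded_functional l -> X @ F --> x ->
  (fun e => l (X e)) @ F --> l x.
Proof.
move=> [ll [c lc]] Xx; apply/subr_cvg0/norm_cvg0P.
apply: (@squeeze_cvgr _ F FF R (fun=> 0) (fun e => c * `|X e - x|)).
- by apply: nearW => e; rewrite normr_ge0 /= -linear_functionalB.
- exact: cvg_cst.
- rewrite -[X in _ --> X](mulr0 c); apply: cvgMl_tmp.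
  by apply/norm_cvg0P/subr_cvg0.
Qed.

(** One argument is replaced at a time; each of the three errors has one factor tending to 0 and the
    others convergent. *)
Lemma bounded_trilinear_cvg I (F : set_system I) {FF : Filter F} T
    (X Y Z : I -> V) x y z : bounded_trilinear T ->
  X @ F --> x -> Y @ F --> y -> Z @ F --> z ->
  (fun e => T (X e) (Y e) (Z e)) @ F --> T x y z.
Proof.
move=> [T1 T2 T3 [c Tc]] Xx Yy Zz; apply/subr_cvg0/norm_cvg0P.
have E e : T (X e) (Y e) (Z e) - T x y z
    = T (X e - x) (Y e) (Z e) + T x (Y e - y) (Z e) + T x y (Z e - z).
  rewrite (linear_functionalB (l := fun x => T x _ _))//.
  by rewrite (linear_functionalB (l := fun y => T _ y _))// linear_functionalB//; ring.
pose B e := c * `|X e - x| * `|Y e| * `|Z e| + c * `|x| * `|Y e - y| * `|Z e|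
  + c * `|x| * `|y| * `|Z e - z|.
apply: (@squeeze_cvgr _ F FF R (fun=> 0) B).
- apply: nearW => e; rewrite normr_ge0 /= E.
  apply: le_trans (ler_normD _ _) _; rewrite lerD//.
  by apply: le_trans (ler_normD _ _) _; rewrite lerD.
- exact: cvg_cst.
- have X0 : (fun e => `|X e - x|) @ F --> 0 by apply/norm_cvg0P/subr_cvg0.
  have Y0 : (fun e => `|Y e - y|) @ F --> 0 by apply/norm_cvg0P/subr_cvg0.
  have Z0 : (fun e => `|Z e - z|) @ F --> 0 by apply/norm_cvg0P/subr_cvg0.
  have Yn : (fun e => `|Y e|) @ F --> `|y| by exact: cvg_norm.
  have Zn : (fun e => `|Z e|) @ F --> `|z| by exact: cvg_norm.
  rewrite (_ : 0 = c * 0 * `|y| * `|z| + c * `|x| * 0 * `|z| + c * `|x| * `|y| * 0).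
    have B1 : (fun e => c * `|X e - x| * `|Y e| * `|Z e|) @ F
        --> c * 0 * `|y| * `|z|.
      by apply: (cvgM _ Zn); apply: (cvgM _ Yn); exact: cvgMl_tmp.
    have B2 : (fun e => c * `|x| * `|Y e - y| * `|Z e|) @ F
        --> c * `|x| * 0 * `|z|.
      by apply: (cvgM _ Zn); exact: cvgMl_tmp.
    have B3 : (fun e => c * `|x| * `|y| * `|Z e - z|) @ F
        --> c * `|x| * `|y| * 0 by exact: cvgMl_tmp.
    exact: cvgD (cvgD B1 B2) B3.
  by ring.
Qed.

Let quot (f : V -> V) (u h : V) (e : R) : V := e^-1 *: (f (e *: h + u) - f u).

Let quot_cvg f u h : differentiable f u -> quot f u h @ 0^' --> 'd f u h.
Proof.
move=> df; rewrite -(deriveE _ df).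
have dK : derivable f u h by exact: diff_derivable.
exact: dK.
Qed.

Let shift_cvg (u h : V) : (fun e : R => e *: h + u) @ 0^' --> u.
Proof.
rewrite -[X in _ --> X]add0r -(scale0r h); apply: cvgD; last exact: cvg_cst.
apply: cvgZl; apply: cvg_within_filter; exact: cvg_id.
Qed.

Let comp_cvg (f : V -> V) (u h : V) : differentiable f u ->
  (fun e : R => f (e *: h + u)) @ 0^' --> f u.
Proof.
move=> /differentiable_continuous fc.
exact: (cvg_comp _ f (@shift_cvg u h) fc).
Qed.

Let quotE l (f : V -> V) u h e : linear_functional l ->
  l (quot f u h e) = e^-1 * (l (f (e *: h + u)) - l (f u)).
Proof. by move=> ll; rewrite /quot (proj2 ll) linear_functionalB. Qed.

(** Both sides are limits of the same real difference quotients along the line through u in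
    direction h, and limits in [R] are unique. *)
Lemma diff_functional l m (K U : V -> V) u h :
  bounded_functional l -> bounded_functional m ->
  differentiable K u -> differentiable U u ->
  (\forall v \near u, l (K v) = m (U v)) -> l ('d K u h) = m ('d U u h).
Proof.
move=> lb mb dK dU KU.
have c1 : (fun e => l (quot K u h e)) @ 0^' --> l ('d K u h).
  exact: bounded_functional_cvg lb (@quot_cvg K u h dK).
have c2 : (fun e => m (quot U u h e)) @ 0^' --> m ('d U u h).
  exact: bounded_functional_cvg mb (@quot_cvg U u h dU).
apply: (cvg_unique (@Rhausdorff R) c1); apply: cvg_trans c2; apply: near_eq_cvg.
have KU' := @shift_cvg u h _ KU.
near=> e; rewrite (quotE _ _ _ _ (proj1 mb)) (quotE _ _ _ _ (proj1 lb)).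
rewrite (nbhs_singleton KU); congr (_ * (_ - _)); symmetry.
by near: e.
Unshelve. all: by end_near.
Qed.

(** Leibniz rule by telescoping: the increment of T(U, U, U) is split into three terms with a single
    difference each, before dividing by e and passing to the limit. *)
Lemma diff_trilinear l T (K U : V -> V) u h :
  bounded_functional l -> bounded_trilinear T ->
  differentiable K u -> differentiable U u ->
  (\forall v \near u, l (K v) = T (U v) (U v) (U v)) ->
  l ('d K u h) = T ('d U u h) (U u) (U u) + T (U u) ('d U u h) (U u)
    + T (U u) (U u) ('d U u h).
Proof.
move=> lb Tb dK dU KU; have [T1 T2 T3 _] := Tb.
have c1 : (fun e => l (quot K u h e)) @ 0^' --> l ('d K u h).
  exact: bounded_functional_cvg lb (@quot_cvg K u h dK).
have cU := @comp_cvg U u h dU; have cQ := @quot_cvg U u h dU.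
have c0 : (fun _ : R => U u) @ 0^' --> U u by exact: cvg_cst.
pose Ue e := U (e *: h + u); pose D e := quot U u h e.
have c2 : (fun e => T (D e) (Ue e) (Ue e) + T (U u) (D e) (Ue e) + T (U u) (U u) (D e))
    @ 0^' --> T ('d U u h) (U u) (U u) + T (U u) ('d U u h) (U u)
    + T (U u) (U u) ('d U u h).
  apply: cvgD; first apply: cvgD.
  - exact: (bounded_trilinear_cvg Tb cQ cU cU).
  - exact: (bounded_trilinear_cvg Tb c0 cQ cU).
  - exact: (bounded_trilinear_cvg Tb c0 c0 cQ).
apply: (cvg_unique (@Rhausdorff R) c1); apply: cvg_trans c2; apply: near_eq_cvg.
have KU' := @shift_cvg u h _ KU.
near=> e; rewrite /D /Ue (quotE _ _ _ _ (proj1 lb)).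
rewrite (quotE (l := fun x => T x _ _))// (quotE (l := fun y => T _ y _))//.
rewrite (quotE (l := T _ _))// (nbhs_singleton KU).
have -> : l (K (e *: h + u)) = T (U (e *: h + u)) (U (e *: h + u)) (U (e *: h + u)).
  by near: e.
by rewrite /=; ring.
Unshelve. all: by end_near.
Qed.

End directional_limits.

(* [v1], [v2] stand for tangent vectors, [X1 i], [X2 i] for the corresponding
   variations of the increments, and [v1 + \sum_j A i j *: X1 j] for that of the
   i-th stage value. *)
Lemma rk_form_invariance {R : realType} {V : lmodType R} {I : finType}
    (w : V -> V -> R) (A : I -> I -> R) (B : I -> R) (X1 X2 : I -> V)
    (v1 v2 : V) :
  (forall y z1 z2, w y (z1 + z2) = w y z1 + w y z2) ->
  (forall z y1 y2, w (y1 + y2) z = w y1 z + w y2 z) ->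
  (forall y r z, w y (r *: z) = r * w y z) ->
  (forall z r y, w (r *: y) z = r * w y z) ->
  (forall i j, B i * B j - B i * A i j - B j * A j i = 0) ->
  (forall i, w (X1 i) (v2 + \sum_j A i j *: X2 j)
           + w (v1 + \sum_j A i j *: X1 j) (X2 i) = 0) ->
  w (v1 + \sum_i B i *: X1 i) (v2 + \sum_i B i *: X2 i) = w v1 v2.
Proof.
move=> wDr wDl wZr wZl AB wX.
have w0r y : w y 0 = 0 by rewrite -(scale0r (0 : V)) wZr mul0r.
have w0l y : w 0 y = 0 by rewrite -(scale0r (0 : V)) wZl mul0r.
have wsr (c : I -> R) (Z : I -> V) y :
    w y (\sum_j c j *: Z j) = \sum_j c j * w y (Z j).
  by rewrite (big_morph _ (wDr y) (w0r y)); apply: eq_bigr => j _; rewrite wZr.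
have wsl (c : I -> R) (Z : I -> V) y :
    w (\sum_j c j *: Z j) y = \sum_j c j * w (Z j) y.
  by rewrite (big_morph _ (wDl y) (w0l y)); apply: eq_bigr => j _; rewrite wZl.
(* The hypothesis on the stages, solved for its part linear in the tangent vectors: the cross terms
   of the step become double sums over pairs of increments. *)
have E i : w (X1 i) v2 + w v1 (X2 i)
    = - \sum_j A i j * (w (X1 i) (X2 j) + w (X1 j) (X2 i)).
  have := wX i; rewrite wDr wDl wsr wsl => /eqP; rewrite addrACA addr_eq0 => /eqP ->.
  by congr (- _); rewrite -big_split; apply: eq_bigr => j _; rewrite mulrDr.
rewrite wDr !wDl !wsr !wsl -addrA -[RHS]addr0; congr (_ + _).
have -> : \sum_i B i * w (\sum_j B j *: X1 j) (X2 i)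
    = \sum_i \sum_j B i * B j * w (X1 i) (X2 j).
  rewrite [RHS]exchange_big /=; apply: eq_bigr => i _.
  rewrite wsl mulr_sumr; apply: eq_bigr => j _.
  by rewrite mulrCA mulrA.
rewrite addrA -big_split /=.
under eq_bigr => i _ do rewrite -mulrDr E mulrN mulr_sumr.
(* Exchanging i and j in the second half brings everything onto w (X1 i) (X2 j), whose total
   coefficient is then the left side of the algebraic condition. *)
have -> : \sum_i - (\sum_j B i * (A i j * (w (X1 i) (X2 j) + w (X1 j) (X2 i))))
  = - (\sum_i \sum_j B i * A i j * w (X1 i) (X2 j)
      + \sum_i \sum_j B j * A j i * w (X1 i) (X2 j)).
  rewrite sumrN [X in _ + X]exchange_big -big_split; congr (- _).
  apply: eq_bigr => i _; rewrite -big_split; apply: eq_bigr => j _ /=.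
  by rewrite mulrDr mulrDr !mulrA.
rewrite addrC -!big_split -sumrB big1// => i _ /=.
rewrite -big_split -sumrB big1// => j _ /=.
by rewrite -[RHS](mul0r (w (X1 i) (X2 j))) -(AB i j); ring.
Qed.

(** * Hamiltonian forms with Hermitian kernels *)

Section more_summability.
Context {R : realType} {I J : choiceType}.

(** Serves to parametrise a frequency constraint by its free frequencies, off which the weighted
    summand vanishes. *)
Lemma abs_summable_range (e : I -> J) (f : J -> R) : injective e ->
  (forall j, ~ range e j -> f j = 0) -> abs_summable (f \o e) -> abs_summable f.
Proof.
move=> ei f0; rewrite /abs_summable.
have -> : (\esum_(j in [set: J]) `|f j|%:E
    = \esum_(j in [set: J]) if j \in range e then `|f j|%:E else 0)%E.
  by apply: eq_esum => j _; case: ifPn => // /negP; rewrite inE => /f0 ->; rewrite normr0.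
by rewrite -esum_mkcond esum_image// => x y _ _; exact: ei.
Qed.

Lemma abs_summable_prod (f : I -> R) (g : J -> R) :
  abs_summable f -> abs_summable g ->
  abs_summable (fun p : I * J => f p.1 * g p.2).
Proof.
move=> sf sg; rewrite /abs_summable.
rewrite -(@esum_pair R I J (fun i j => `|f i * g j|%:E)); last first.
  by move=> i j; rewrite lee_fin.
pose G := fine (\esum_(j in [set: J]) `|g j|%:E).
have GE : (\esum_(j in [set: J]) `|g j|%:E = G%:E)%E.
  by rewrite fineK//; apply/(ge0_abs_summableP (fun i => normr_ge0 (g i)))/abs_summable_norm.
have G0 : 0 <= G by rewrite fine_ge0// esum_ge0.
have := abs_summableZ G sf; apply: le_lt_trans; apply: le_esum => i _.
under eq_esum do rewrite normrM.
apply: le_trans (esumZ_le (normr_ge0 (f i)) (fun j => normr_ge0 (g j))) _.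
by rewrite GE -EFinM lee_fin normrM (ger0_norm G0) mulrC.
Qed.

End more_summability.

Lemma sform_functional {R : realType} {s : R} (w : Hs R s) : 1 < s ->
  bounded_functional (fun v : Hs R s => sform v w).
Proof.
move=> s1; split; first by split=> [x y|a x]; rewrite ?(sformDl s1) ?(sformZl s1).
exists (rsum setT (decay s) * `|w|) => x.
by apply: le_trans (sform_le s1 x w) _; rewrite -mulrA [`|w| * _]mulrC.
Qed.

(** * The quartic form of the cubic nonlinearity *)

Section quartic_form.
Context {R : realType} {s : R}.
Hypothesis s1 : 1 < s.
Local Notation C := R[i].
Local Notation Hs := (Hs R s).

Definition resonant (k : int) : set (int * int * int) :=
  [set j | k + j.1.1 = j.1.2 + j.2].

Let decay3 (k : int) (j : int * int * int) : R :=
  decay s j.1.1 * decay s j.1.2 * decay s j.2.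

Let decay3_ge0 k j : 0 <= decay3 k j.
Proof. by rewrite !mulr_ge0 ?decay_ge0. Qed.

Let s0 : 0 <= s. Proof. exact/ltW/lt_trans/s1. Qed.

(** Given k, k1 and k2, resonance fixes k3. Of the four decay factors, that of k3 is bounded by 1
    and the other three form a product of summable families in free variables. *)
Let decay3_summable : abs_summable (pairing_weight (s := s) resonant decay3).
Proof.
pose e (q : int * (int * int)) := (q.1, (q.2.1, q.2.2, q.1 + q.2.1 - q.2.2)).
apply: (@abs_summable_range _ _ _ e) => [[k [i j]] [k' [i' j']] [] //|[k [[i j] l]]|].
- by move=> /= -> -> ->.
- rewrite /pairing_weight /=; case: ifPn => //; rewrite inE /resonant /= => E.
  by case; exists (k, (i, j)) => //; rewrite /e /= E addrC addKr.
have ss := decay_summable s1.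
apply: (le_abs_summable _ (abs_summable_prod ss (abs_summable_prod ss ss))).
move=> [k [i j]]; rewrite /pairing_weight /= mem_set; last first.
  by rewrite /resonant /=; ring.
have d0 := @decay_ge0 R s.
rewrite !ger0_norm ?mulr_ge0//= /decay3 /= [leLHS]mulrC.
by rewrite ler_wpM2l// -[leRHS]mulr1 ler_wpM2l ?mulr_ge0// decay_le1.
Qed.

Variables (M : int -> int * int * int -> C) (cM : R).
Hypothesis M_le : forall k j, cabs (M k j) <= cM.
Hypothesis M_swap : forall k k1 k2 k3, M k (k1, k2, k3) = M k1 (k, k2, k3).
Hypothesis M_herm : forall k k1 k2 k3, M k2 (k3, k, k1) = (M k (k1, k2, k3))^*%C.

Let term (x y z : Hs) (k : int) (j : int * int * int) : C :=
  M k j * (x j.1.1)^*%C * y j.1.2 * z j.2.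

(* Re \sum_{k + k1 = k2 + k3} M_k \bar{w_k} \bar{x_k1} y_k2 z_k3 *)
Let quartic (w x y z : Hs) : R := pairing resonant (term x y z) w.

Let cM0 : 0 <= cM.
Proof. exact: le_trans (cabs_ge0 _) (M_le 0 (0, 0, 0)). Qed.

Let term_dominated x y z :
  dominated resonant (term x y z) (cM * `|x| * `|y| * `|z|) decay3.
Proof.
move=> k j _; rewrite /term /decay3 !cabsM cabs_conj.
have nn := @normr_ge0 R Hs; have c0 := @cabs_ge0 R; have d0 := @decay_ge0 R s.
apply: le_trans (_ : _ <= cM * (`|x| * decay s j.1.1) * (`|y| * decay s j.1.2)
    * (`|z| * decay s j.2)) _; last by rewrite le_eqVlt; apply/orP; left; apply/eqP; ring.
by rewrite !ler_pM ?mulr_ge0 ?cabs_coef_le.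
Qed.

Let quarticD2 w x x' y z : quartic w (x + x') y z = quartic w x y z + quartic w x' y z.
Proof.
transitivity (pairing resonant (fun k j => term x y z k j + term x' y z k j) w);
  last exact: (pairingDl decay3_summable w (term_dominated x y z) (term_dominated x' y z)).
apply: eq_pairing => k j.
by rewrite /term Defs.coefD rmorphD mulrDr !mulrDl.
Qed.

Let quarticD3 w x y y' z : quartic w x (y + y') z = quartic w x y z + quartic w x y' z.
Proof.
transitivity (pairing resonant (fun k j => term x y z k j + term x y' z k j) w);
  last exact: (pairingDl decay3_summable w (term_dominated x y z) (term_dominated x y' z)).
apply: eq_pairing => k j.
by rewrite /term Defs.coefD mulrDr mulrDl.
Qed.

Let quarticD4 w x y z z' : quartic w x y (z + z') = quartic w x y z + quartic w x y z'.
Proof.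
transitivity (pairing resonant (fun k j => term x y z k j + term x y z' k j) w);
  last exact: (pairingDl decay3_summable w (term_dominated x y z) (term_dominated x y z')).
apply: eq_pairing => k j.
by rewrite /term Defs.coefD mulrDr.
Qed.

Let quarticZ2 w a x y z : quartic w (a *: x) y z = a * quartic w x y z.
Proof.
transitivity (pairing resonant (fun k j => a%:C%C * term x y z k j) w);
  last exact: (pairingZl decay3_summable _ w (term_dominated x y z)).
apply: eq_pairing => k j.
rewrite /term Defs.coefZ (_ : (a%:C%C * _)^*%C = a%:C%C * (x j.1.1)^*%C); last first.
  by case: (x j.1.1) => p q; apply: eq_ReIm => /=; ring.
by ring.
Qed.

Let quarticZ3 w a x y z : quartic w x (a *: y) z = a * quartic w x y z.
Proof.
transitivity (pairing resonant (fun k j => a%:C%C * term x y z k j) w);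
  last exact: (pairingZl decay3_summable _ w (term_dominated x y z)).
apply: eq_pairing => k j.
by rewrite /term Defs.coefZ; ring.
Qed.

Let quarticZ4 w a x y z : quartic w x y (a *: z) = a * quartic w x y z.
Proof.
transitivity (pairing resonant (fun k j => a%:C%C * term x y z k j) w);
  last exact: (pairingZl decay3_summable _ w (term_dominated x y z)).
apply: eq_pairing => k j.
by rewrite /term Defs.coefZ; ring.
Qed.

Let quartic_trilinear w (r : R) :
  bounded_trilinear (fun x y z => r * quartic w x y z).
Proof.
split=> [y z|x z|x y|].
- by split=> [x x'|a x]; rewrite ?quarticD2 ?quarticZ2; ring.
- by split=> [y y'|a y]; rewrite ?quarticD3 ?quarticZ3; ring.
- by split=> [z z'|a z]; rewrite ?quarticD4 ?quarticZ4; ring.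
set W := rsum setT (pairing_weight (s := s) resonant decay3).
exists (`|r| * (cM * `|w| * W)) => x y z; rewrite normrM.
have := pairing_le decay3_ge0 decay3_summable w (term_dominated x y z).
move=> /(ler_wpM2l (normr_ge0 r)) /le_trans; apply.
by rewrite le_eqVlt; apply/orP; left; apply/eqP; rewrite -/W; ring.
Qed.

(** The involution exchanging k and k1 preserves resonance, and the kernel is invariant under it. *)
Let quartic_swap w x y z : quartic w x y z = quartic x w y z.
Proof.
pose e (p : int * (int * int * int)) := (p.2.1.1, ((p.1, p.2.1.2), p.2.2)).
have eb : bijective e by exists e => -[k [[i j] l]].
rewrite /quartic /pairing (rsum_reindex _ eb); congr rsum; apply/funext.
move=> [k [[k1 k2] k3]]; rewrite /pairing_term /= /term /=.
have -> : ((k1, k2, k3) \in resonant k) = ((k, k2, k3) \in resonant k1).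
  by apply/idP/idP; rewrite !inE /resonant /= addrC.
by case: ifP => // _; rewrite M_swap; congr Re; ring.
Qed.

(** Exchanging the pairs (k, k1) and (k2, k3) conjugates the kernel, hence each summand as a whole,
    and leaves its real part unchanged. *)
Let quartic_herm w x y z : quartic w x y z = quartic y z w x.
Proof.
pose e (p : int * (int * int * int)) := (p.2.1.2, ((p.2.2, p.1), p.2.1.1)).
have eb : bijective e by exists e => -[k [[i j] l]].
rewrite /quartic /pairing [RHS](rsum_reindex _ eb); congr rsum; apply/funext.
move=> [k [[k1 k2] k3]]; rewrite /pairing_term /= /term /=.
have -> : ((k1, k2, k3) \in resonant k) = ((k3, k, k1) \in resonant k2).
  by apply/idP/idP; rewrite !inE /resonant /= => ->.
case: ifP => // _; rewrite M_herm.
by case: (M _ _); case: (w _); case: (x _); case: (y _); case: (z _) => * /=; ring.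
Qed.

(** The three terms of the derivative in direction x, tested against y, are each symmetric in x and
    y: up to a constant they make up the Hessian of the quartic form at U. *)
Let quartic_sym1 U x y : quartic y x U U = quartic x y U U.
Proof. exact: quartic_swap. Qed.

Let quartic_sym2 U x y : quartic y U x U = quartic x U y U.
Proof. exact: quartic_herm. Qed.

Let quartic_sym3 U x y : quartic y U U x = quartic x U U y.
Proof. by rewrite quartic_swap quartic_herm quartic_swap. Qed.

(* The nonlinearity is the Hamiltonian vector field of a real quartic form, so
   its derivative is infinitesimally symplectic. *)
Lemma resonant_hamiltonian (r : R) (K U : Hs -> Hs) u a b :
  differentiable K u -> differentiable U u ->
  (\forall v \near u, forall k, K v k = - 'i%C * r%:C%C * csum (resonant k)
     (fun j => M k j * (U v j.1.1)^*%C * U v j.1.2 * U v j.2)) ->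
  sform ('d K u a) ('d U u b) + sform ('d U u a) ('d K u b) = 0.
Proof.
move=> dK dU KE.
have E h w : sform ('d K u h) w = - r * quartic w ('d U u h) (U u) (U u)
    + - r * quartic w (U u) ('d U u h) (U u) + - r * quartic w (U u) (U u) ('d U u h).
  apply: (diff_trilinear h (sform_functional w s1) (quartic_trilinear w (- r)) dK dU).
  apply: filterS KE => v KE.
  exact: (sform_pairing decay3_summable w (term_dominated (U v) (U v) (U v)) KE).
rewrite [X in _ + X]sformC !E.
by rewrite quartic_sym1 quartic_sym2 quartic_sym3; ring.
Qed.

End quartic_form.

(** * The quadratic form of the noise term *)

Section quadratic_form.
Context {R : realType} {s : R}.
Hypothesis s1 : 1 < s.
Local Notation C := R[i].
Local Notation Hs := (Hs R s).

Definition convolution (k : int) : set (int * int) := [set j | k = j.1 + j.2].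

Variable B : int -> int * int -> C.
Hypothesis B_summable : abs_summable (fun q : int * int =>
  decay s q.1 * decay s q.2 * cabs (B q.1 (q.2, q.1 - q.2))).
Hypothesis B_herm : forall k k1 k2, k = k1 + k2 ->
  B k1 (k, - k2) = (B k (k1, k2))^*%C.

(** The kernel is part of the envelope instead of being bounded by a constant in front, because for
    the noise only summability against the decay factors is established. *)
Let gB (k : int) (j : int * int) : R := decay s j.1 * cabs (B k j).

Let gB0 k j : 0 <= gB k j.
Proof. by rewrite mulr_ge0 ?decay_ge0 ?cabs_ge0. Qed.

Let gB_summable : abs_summable (pairing_weight (s := s) convolution gB).
Proof.
pose e (q : int * int) := (q.1, (q.2, q.1 - q.2)).
apply: (@abs_summable_range _ _ _ e) => [[k i] [k' i'] [-> ->] //|[k [i j]]|].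
- rewrite /pairing_weight /=; case: ifPn => //; rewrite inE /convolution /= => E.
  by case; exists (k, i) => //; rewrite /e /= E addrAC subrr add0r.
apply: le_abs_summable B_summable => -[k i]; rewrite /pairing_weight /=.
rewrite mem_set; last by rewrite /convolution /=; ring.
by rewrite /gB /= mulrC mulrA.
Qed.

Let term (v : Hs) (k : int) (j : int * int) : C := v j.1 * B k j.

Let quadratic (w v : Hs) : R := pairing convolution (term v) w.

Let term_dominated v : dominated convolution (term v) `|v| gB.
Proof.
move=> k j _; rewrite /term /gB cabsM mulrA.
by rewrite ler_wpM2r ?cabs_ge0 ?cabs_coef_le.
Qed.

Let quadratic_functional w (r : R) : bounded_functional (fun v => r * quadratic w v).
Proof.
split; [split=> [x y|a x]|].
- rewrite -mulrDr; congr (_ * _).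
  transitivity (pairing convolution (fun k j => term x k j + term y k j) w);
    last exact: (pairingDl gB_summable w (term_dominated x) (term_dominated y)).
  apply: eq_pairing => k j.
  by rewrite /term Defs.coefD mulrDl.
- rewrite mulrCA; congr (_ * _).
  transitivity (pairing convolution (fun k j => a%:C%C * term x k j) w);
    last exact: (pairingZl gB_summable _ w (term_dominated x)).
  apply: eq_pairing => k j.
  by rewrite /term Defs.coefZ mulrA.
set W := rsum setT (pairing_weight (s := s) convolution gB).
exists (`|r| * (`|w| * W)) => x; rewrite normrM.
have := pairing_le gB0 gB_summable w (term_dominated x).
move=> /(ler_wpM2l (normr_ge0 r)) /le_trans; apply.
by rewrite le_eqVlt; apply/orP; left; apply/eqP; rewrite -/W; ring.
Qed.

(** The involution (k, k1, k2) -> (k1, k, -k2) preserves k = k1 + k2 and conjugates the kernel, so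
    real parts agree term by term. *)
Let quadratic_sym w v : quadratic w v = quadratic v w.
Proof.
pose e (p : int * (int * int)) := (p.2.1, (p.1, - p.2.2)).
have eb : bijective e by exists e => -[k [i j]]; rewrite /e /= opprK.
rewrite /quadratic /pairing [RHS](rsum_reindex _ eb); congr rsum; apply/funext.
move=> [k [k1 k2]]; rewrite /pairing_term /= /term /=.
have -> : ((k, - k2) \in convolution k1) = ((k1, k2) \in convolution k).
  by apply/idP/idP; rewrite !inE /convolution /= => ->; ring.
case: ifPn => //; rewrite inE /convolution /= => /B_herm ->.
by case: (B _ _); case: (w _); case: (v _) => * /=; ring.
Qed.

Lemma convolution_hamiltonian (r : R) (L U : Hs -> Hs) u a b :
  differentiable L u -> differentiable U u ->
  (\forall v \near u, forall k, L v k = - 'i%C * r%:C%C * csum (convolution k)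
     (fun j => U v j.1 * B k j)) ->
  sform ('d L u a) ('d U u b) + sform ('d U u a) ('d L u b) = 0.
Proof.
move=> dL dU LE.
have E h w : sform ('d L u h) w = - r * quadratic w ('d U u h).
  apply: (diff_functional h (sform_functional w s1) (quadratic_functional w (- r)) dL dU).
  apply: filterS LE => v LE.
  exact: (sform_pairing gB_summable w (term_dominated (U v)) LE).
by rewrite [X in _ + X]sformC !E quadratic_sym subrr.
Qed.

End quadratic_form.

(** * Bounded and Lipschitz integrands *)

Section bounded_on.
Context {R : realType} (t : R).
Implicit Types (f g : R -> R) (F G : R -> R[i]) (M N : R).

(** The bound is restricted to [0, t], where all integrals live, so that polynomials belong to the
    class. *)
Definition bounded_on M f :=
  measurable_fun setT f /\ forall x, 0 <= x <= t -> `|f x| <= M.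

(* membership in the class with constant [M] bounds both the sup norm and the
   Lipschitz constant on [0, t] *)
Definition lipschitz_on M f :=
  bounded_on M f /\ forall x y, 0 <= x <= t -> 0 <= y <= t ->
    `|f x - f y| <= M * `|x - y|.

Definition cbounded_on M F :=
  bounded_on M (fun x => Re (F x)) /\ bounded_on M (fun x => Im (F x)).

Definition clipschitz_on M F :=
  lipschitz_on M (fun x => Re (F x)) /\ lipschitz_on M (fun x => Im (F x)).

Lemma bounded_onD M N f g : bounded_on M f -> bounded_on N g ->
  bounded_on (M + N) (fun x => f x + g x).
Proof.
move=> [mf fM] [mg gN]; split=> [|x x0]; first exact: measurable_funD.
by apply: le_trans (ler_normD _ _) _; rewrite lerD ?fM ?gN.
Qed.

Lemma bounded_onN M f : bounded_on M f -> bounded_on M (fun x => - f x).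
Proof.
move=> [mf fM]; split=> [|x x0]; last by rewrite normrN fM.
exact: measurableT_comp.
Qed.

Lemma bounded_onM M N f g : bounded_on M f -> bounded_on N g ->
  bounded_on (M * N) (fun x => f x * g x).
Proof.
move=> [mf fM] [mg gN]; split=> [|x x0]; first exact: measurable_funM.
by rewrite normrM ler_pM ?fM ?gN.
Qed.

Lemma lipschitz_onD M N f g : lipschitz_on M f -> lipschitz_on N g ->
  lipschitz_on (M + N) (fun x => f x + g x).
Proof.
move=> [bf fM] [bg gN]; split=> [|x y x0 y0]; first exact: bounded_onD.
rewrite opprD addrACA mulrDl; apply: le_trans (ler_normD _ _) _.
by rewrite lerD ?fM ?gN.
Qed.

Lemma lipschitz_onN M f : lipschitz_on M f -> lipschitz_on M (fun x => - f x).
Proof.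
move=> [bf fM]; split=> [|x y x0 y0]; first exact: bounded_onN.
by rewrite -opprD normrN fM.
Qed.

Lemma lipschitz_onM M N f g : 0 <= t -> lipschitz_on M f -> lipschitz_on N g ->
  lipschitz_on (2 * (M * N)) (fun x => f x * g x).
Proof.
move=> t0 [bf fM] [bg gN]; have [_ bfM] := bf; have [_ bgN] := bg.
have z0 : 0 <= (0 : R) <= t by rewrite lexx.
have M0 : 0 <= M by exact: le_trans (bfM 0 z0).
have N0 : 0 <= N by exact: le_trans (bgN 0 z0).
split=> [|x y x0 y0].
  have [mfg fgM] := bounded_onM bf bg; split=> // x x0.
  by apply: le_trans (fgM x x0) _; rewrite ler_peMl ?mulr_ge0// ler1n.
have -> : f x * g x - f y * g y = f x * (g x - g y) + (f x - f y) * g y by ring.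
apply: le_trans (ler_normD _ _) _; rewrite !normrM.
have -> : 2 * (M * N) * `|x - y| = M * (N * `|x - y|) + (M * `|x - y|) * N by ring.
by rewrite lerD// ler_pM ?bfM ?bgN ?fM ?gN.
Qed.

Lemma clipschitz_onD M N F G : clipschitz_on M F -> clipschitz_on N G ->
  clipschitz_on (M + N) (fun x => F x + G x).
Proof.
move=> [F1 F2] [G1 G2]; split.
- by have := lipschitz_onD F1 G1; congr lipschitz_on; apply/funext => x;
    case: (F x); case: (G x).
- by have := lipschitz_onD F2 G2; congr lipschitz_on; apply/funext => x;
    case: (F x); case: (G x).
Qed.

(** The factor 4 is 2 from the Leibniz splitting in [lipschitz_onM] times 2 for the two real
    products in each component. *)
Lemma clipschitz_onM M N F G : 0 <= t -> clipschitz_on M F ->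
  clipschitz_on N G -> clipschitz_on (4 * (M * N)) (fun x => F x * G x).
Proof.
move=> t0 [F1 F2] [G1 G2].
have -> : 4 * (M * N) = 2 * (M * N) + 2 * (M * N) by ring.
split.
- have := lipschitz_onD (lipschitz_onM t0 F1 G1)
    (lipschitz_onN (lipschitz_onM t0 F2 G2)).
  by congr lipschitz_on; apply/funext => x; case: (F x); case: (G x).
- have := lipschitz_onD (lipschitz_onM t0 F1 G2) (lipschitz_onM t0 F2 G1).
  by congr lipschitz_on; apply/funext => x; case: (F x); case: (G x).
Qed.

Lemma clipschitz_on_cst (c : R[i]) : clipschitz_on (cabs c) (fun=> c).
Proof.
by split; split; try split=> [|x _]; rewrite ?normr_Re_le ?normr_Im_le//;
  move=> x y _ _; rewrite subrr normr0 mulr_ge0 ?cabs_ge0.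
Qed.

(** In 1 + t the summand t accounts for the sup norm and 1 for the Lipschitz constant. *)
Lemma clipschitz_on_real : 0 <= t -> clipschitz_on (1 + t) (fun x => x%:C%C).
Proof.
move=> t0; split; split; try (split=> [|x /andP[x0 xt]]);
  rewrite ?normr0 ?addr_ge0 ?ger0_norm//=.
- by rewrite (le_trans xt)// lerDr.
- by move=> x y _ _; rewrite mulrDl mul1r lerDl mulr_ge0.
- by move=> x y _ _; rewrite subrr normr0 mulr_ge0 ?addr_ge0.
Qed.

Lemma clipschitz_on_poly (p : {poly R[i]}) : 0 <= t ->
  exists M, clipschitz_on M (fun x => p.[x%:C%C]).
Proof.
move=> t0; elim/poly_ind: p => [|p c [M pM]].
  by exists (cabs (0 : R[i])); under eq_fun do rewrite horner0;
    exact: clipschitz_on_cst.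
eexists; under eq_fun do rewrite hornerMXaddC.
apply: clipschitz_onD (clipschitz_on_cst c).
exact: (clipschitz_onM t0 pM (clipschitz_on_real t0)).
Qed.

Lemma clipschitz_on_sum (I : Type) (r : seq I) (M : I -> R) (F : I -> R -> R[i]) :
  (forall i, clipschitz_on (M i) (F i)) ->
  clipschitz_on (\sum_(i <- r) M i) (fun x => \sum_(i <- r) F i x).
Proof.
move=> FM; elim: r => [|i r IH].
  rewrite big_nil; under eq_fun do rewrite big_nil.
  have := clipschitz_on_cst 0.
  by rewrite (_ : cabs 0 = 0 :> R)// /cabs /sqnc /= expr0n addr0 sqrtr0.
rewrite big_cons (_ : (fun x => _) = fun x => F i x + \sum_(j <- r) F j x).
  exact: clipschitz_onD.
by apply/funext => x; rewrite big_cons.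
Qed.

Lemma clipschitz_on_bounded M F : clipschitz_on M F -> cbounded_on M F.
Proof. by move=> [[? _] [? _]]. Qed.

Lemma cbounded_onD M N F G : cbounded_on M F -> cbounded_on N G ->
  cbounded_on (M + N) (fun x => F x + G x).
Proof.
move=> [F1 F2] [G1 G2]; split.
- by have := bounded_onD F1 G1; congr bounded_on; apply/funext => x;
    case: (F x); case: (G x).
- by have := bounded_onD F2 G2; congr bounded_on; apply/funext => x;
    case: (F x); case: (G x).
Qed.

Lemma cbounded_onN M F : cbounded_on M F -> cbounded_on M (fun x => - F x).
Proof.
move=> [F1 F2]; split.
- by have := bounded_onN F1; congr bounded_on; apply/funext => x; case: (F x).
- by have := bounded_onN F2; congr bounded_on; apply/funext => x; case: (F x).
Qed.

Lemma cbounded_onM M N F G : cbounded_on M F -> cbounded_on N G ->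
  cbounded_on (M * N + M * N) (fun x => F x * G x).
Proof.
move=> [F1 F2] [G1 G2]; split.
- have := bounded_onD (bounded_onM F1 G1) (bounded_onN (bounded_onM F2 G2)).
  by congr bounded_on; apply/funext => x; case: (F x); case: (G x).
- have := bounded_onD (bounded_onM F1 G2) (bounded_onM F2 G1).
  by congr bounded_on; apply/funext => x; case: (F x); case: (G x).
Qed.

(** A Lipschitz constant here would grow like |a|; the sup bound is uniform in a and suffices for
    the Lebesgue integrals of the deterministic kernel. *)
Lemma cbounded_on_osc (a : int) : cbounded_on 1 (osc a).
Proof.
have mlin : measurable_fun setT (fun x : R => x * a%:~R) by exact: measurable_funM.
split; split=> [|x _].
- by apply: measurableT_comp mlin; apply: continuous_measurable_fun; exact: continuous_cos.
- by rewrite /= ler_norml cos_geN1 cos_le1.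
- by apply: measurableT_comp mlin; apply: continuous_measurable_fun; exact: continuous_sin.
- by rewrite /= ler_norml sin_geN1 sin_le1.
Qed.

Lemma bounded_on_integrable M f (b : R) : b <= t -> bounded_on M f ->
  lebesgue_measure.-integrable `[0, b] (EFin \o f).
Proof.
move=> bt [mf fM]; apply: measurable_bounded_integrable => //.
- by rewrite /= lebesgue_measure_itv/=; case: ifP => _; rewrite ?ltry// -EFinB ltry.
- exact: measurable_funTS.
exists M; split; first exact: num_real.
move=> N MN x /=; rewrite in_itv /= => /andP[x0 xb].
by apply: le_trans (fM x _) (ltW MN); rewrite x0 (le_trans xb).
Qed.

Lemma norm_Rintegral_le M f (b : R) : 0 <= b <= t -> bounded_on M f ->
  `|Rintegral lebesgue_measure `[0, b] f| <= M * b.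
Proof.
move=> /andP[b0 bt] fM; have fi := bounded_on_integrable bt fM.
apply: le_trans (le_normr_Rintegral _ fi) _ => //.
have -> : M * b = Rintegral lebesgue_measure `[0, b] (fun=> M).
  rewrite Rintegral_cst//= lebesgue_measure_itv/= lte_fin.
  by case: ltgtP b0 => // [_|<-] _; rewrite ?mulr0//= subr0.
apply: le_Rintegral => //.
- apply: (bounded_on_integrable bt (M := M)); split=> [|x x0].
    by apply: measurableT_comp => //; exact: (proj1 fM).
  by rewrite normr_id; exact: (proj2 fM).
- by apply: (bounded_on_integrable bt (M := `|M|)); split.
- move=> x /=; rewrite in_itv /= => /andP[x0 xb].
  by apply: (proj2 fM); rewrite x0 (le_trans xb).
Qed.

End bounded_on.

Lemma cintegral_conj {R : realType} (t M b : R) (F : R -> R[i]) :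
  b <= t -> cbounded_on t M F ->
  cintegral 0 b (fun x => (F x)^*%C) = (cintegral 0 b F)^*%C.
Proof.
move=> bt [F1 F2]; apply: eq_ReIm; rewrite /cintegral /=.
  by congr Rintegral; apply/funext => x; case: (F x).
rewrite -[RHS]mulN1r -RintegralZl//; last exact: bounded_on_integrable F2.
by congr Rintegral; apply/funext => x; case: (F x) => ? ? /=; ring.
Qed.

(** * The interpolated kernels *)

Section interpolated_oscillations.
Context {R : realType} (d : nat) (gam : 'I_d -> R) (t : R).
Hypotheses (t0 : 0 < t) (gam_inj : injective gam).
Local Notation C := R[i].

Let tN0 : t != 0. Proof. by rewrite gt_eqF. Qed.

Lemma osc_conj (a : int) (x : R) : osc (- a) x = (osc a x)^*%C.
Proof. by apply: eq_ReIm; rewrite /= rmorphN mulrN ?cosN ?sinN. Qed.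

(** The nodes are real, so conjugating the coefficients of an interpolant gives a polynomial that
    interpolates the conjugate data; uniqueness concludes. *)
Lemma Posc_conj (a : int) (x : R) : Posc gam t (- a) x = (Posc gam t a x)^*%C.
Proof.
have conjR (y : R) : (y%:C%C : C)^*%C = y%:C%C by rewrite /= oppr0.
have [sz val] := interpP (osc a) tN0 gam_inj.
rewrite /Posc -(@interp_unique _ d gam t _ (map_poly conjc (interp gam t (osc a))))//.
- by rewrite -[in LHS]conjR horner_map.
- by rewrite (leq_trans (size_poly _ _)).
- by move=> j; rewrite -[in LHS]conjR horner_map /= val osc_conj.
Qed.

(** The Lagrange basis polynomials, obtained by interpolating the indicator of one node. *)
Let node (j : 'I_d) : {poly C} := interp gam t (fun x => (x == t * gam j)%:R).

Let PoscE a x : Posc gam t a x = \sum_j osc a (t * gam j) * (node j).[x%:C%C].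
Proof.
rewrite /Posc -(@interp_unique _ d gam t _ (\sum_j osc a (t * gam j) *: node j))//.
- by rewrite horner_sum; apply: eq_bigr => j _; rewrite hornerZ.
- apply: (leq_trans (size_sum _ _ _)); apply/bigmax_leqP => j _.
  apply: (leq_trans (size_scale_leq _ _)).
  by have [] := interpP (fun x => (x == t * gam j)%:R) tN0 gam_inj.
move=> i; have nodeE j : (node j).[(t * gam i)%:C%C] = (i == j)%:R.
  have [_ ->] := interpP (fun x => (x == t * gam j)%:R) tN0 gam_inj.
  by rewrite (inj_eq (mulfI tN0)) (inj_eq gam_inj).
rewrite horner_sum (bigD1 i)//= big1 ?addr0 => [|j ji]; rewrite hornerZ nodeE.
  by rewrite eqxx mulr1.
by rewrite eq_sym (negbTE ji) mulr0.
Qed.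

(** By Lagrange's formula the frequency a enters only through coefficients of modulus 1, while the
    basis polynomials depend on the nodes alone. *)
Lemma Posc_lipschitz : exists M, forall a, clipschitz_on t M (Posc gam t a).
Proof.
have [M nodeM] := choice (fun j => clipschitz_on_poly (node j) (ltW t0)).
exists (\sum_j 4 * (1 * M j)) => a.
rewrite (_ : Posc gam t a = fun x => \sum_j osc a (t * gam j) * (node j).[x%:C%C]).
  apply: clipschitz_on_sum => j; apply: clipschitz_onM (ltW t0) _ (nodeM j).
  by have := @clipschitz_on_cst _ t (osc a (t * gam j)); rewrite cabs_cis.
by apply/funext => x; rewrite PoscE.
Qed.

Lemma Posc_monomial_lipschitz (p : nat) : exists M, forall a,
  clipschitz_on t M (fun x => Posc gam t a x * (x ^+ p)%:C%C).
Proof.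
have [M PM] := Posc_lipschitz.
have [N pN] := @clipschitz_on_poly _ t 'X^p (ltW t0).
exists (4 * (M * N)) => a; apply: clipschitz_onM (ltW t0) (PM a) _.
by have := pN; congr clipschitz_on; apply/funext => x; rewrite hornerXn -rmorphXn.
Qed.

Lemma kernel2d_swap x k k1 k2 k3 :
  kernel2d gam t x k k1 k2 k3 = kernel2d gam t x k1 k k2 k3.
Proof. by rewrite /kernel2d (_ : 2 * k * k1 = 2 * k1 * k)//; ring. Qed.

(** The exchange maps the pair of phases (-2 k k1, 2 k2 k3) to its negative in reverse order: the
    first two products trade places up to conjugation and the third is conjugated. *)
Lemma kernel2d_herm x k k1 k2 k3 :
  kernel2d gam t x k2 k3 k k1 = (kernel2d gam t x k k1 k2 k3)^*%C.
Proof.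
rewrite /kernel2d !osc_conj !Posc_conj.
case: (osc _ x) => *; case: (osc _ x) => *; case: (Posc _ _ _ x) => *.
by case: (Posc _ _ _ x) => *; apply: eq_ReIm => /=; ring.
Qed.

Lemma kernel2d_bounded (p : nat) : exists M, forall k k1 k2 k3,
  cbounded_on t M (fun x => kernel2d gam t x k k1 k2 k3 * (x ^+ p)%:C%C).
Proof.
have [M PM] := Posc_lipschitz.
have [N pN] := @clipschitz_on_poly _ t 'X^p (ltW t0).
have PB a := clipschitz_on_bounded (PM a).
have pB : cbounded_on t N (fun x => (x ^+ p)%:C%C).
  have := clipschitz_on_bounded pN; congr cbounded_on; apply/funext => x.
  by rewrite hornerXn -rmorphXn.
have oB a := cbounded_on_osc t a.
(* The constant is created before the frequencies are introduced and is then found by unification,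
   so it is uniform in them. *)
eexists => k k1 k2 k3; apply: cbounded_onM pB; apply: cbounded_onD.
  by apply: cbounded_onD; apply: cbounded_onM (oB _) (PB _).
by apply: cbounded_onN; apply: cbounded_onM (PB _) (PB _).
Qed.

End interpolated_oscillations.

(** * The deterministic map *)

Section deterministic_stage.
Context {R : realType} (s : R) (d : nat) (gam : 'I_d -> R) (t : R).
Hypotheses (s1 : 1 < s) (t0 : 0 < t) (gam_inj : injective gam).
Local Notation C := R[i].
Local Notation Hs := (Hs R s).

Lemma Fmap_hamiltonian (lam : R) (p : nat) (c : R) (K U : Hs -> Hs) u a b :
  0 <= c <= 1 -> differentiable K u -> differentiable U u ->
  (\forall v \near u, forall k, K v k = Fmap gam t lam p c (U v) k) ->
  sform ('d K u a) ('d U u b) + sform ('d U u a) ('d K u b) = 0.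
Proof.
move=> /andP[c0 c1] dK dU KE.
have ct : 0 <= c * t <= t.
  by rewrite mulr_ge0 ?(ltW t0)//= ler_piMl// ltW.
have [N NM] := kernel2d_bounded t0 gam_inj p.
pose M (k : int) (j : int * int * int) : C := ((t ^+ p.+1)^-1)%:C%C *
  cintegral 0 (c * t) (fun x => kernel2d gam t x k j.1.1 j.1.2 j.2 * (x ^+ p)%:C%C).
apply: (@resonant_hamiltonian _ s s1 M (`|(t ^+ p.+1)^-1| * (N * (c * t) + N * (c * t)))
  _ _ _ lam _ _ _ _ _ dK dU KE).
- move=> k [[k1 k2] k3]; rewrite /M cabsM cabs_real ler_wpM2l//.
  have [R1 I1] := NM k k1 k2 k3.
  apply: le_trans (cabs_le _) _.
  exact: lerD (norm_Rintegral_le ct R1) (norm_Rintegral_le ct I1).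
- by move=> k k1 k2 k3; rewrite /M /=; under [in LHS]eq_fun do rewrite kernel2d_swap.
- move=> k k1 k2 k3; rewrite /M /=.
  have ctt : c * t <= t by case/andP: ct.
  have := cintegral_conj ctt (NM k k1 k2 k3).
  rewrite (_ : (fun x => _^*%C) = fun x => kernel2d gam t x k2 k3 k k1 * (x ^+ p)%:C%C).
    by move=> ->; apply: eq_ReIm => /=; ring.
  apply/funext => x; rewrite (kernel2d_herm t0 gam_inj x k k1 k2 k3).
  case: (kernel2d _ _ _ _ _ _ _) => e f; by apply: eq_ReIm => /=; ring.
Qed.

End deterministic_stage.

(** * Normal law and Wiener integrals *)

Section density.
Context d (T : measurableType d) (R : realType).
Variables (mu nu : {measure set T -> \bar R}) (g : T -> R).
Hypotheses (g0 : forall x, 0 <= g x) (mg : measurable_fun setT g).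
Hypothesis nuE : forall A, measurable A ->
  nu A = (\int[mu]_(x in A) (g x)%:E)%E.

Import HBNNSimple.

Let integral_density_indic E : measurable E ->
  (\int[nu]_x (\1_E x)%:E = \int[mu]_x ((\1_E x)%:E * (g x)%:E))%E.
Proof.
move=> mE; rewrite integral_indic//= setIT nuE// [LHS]integral_mkcond.
by apply: eq_integral => x _; rewrite patchE indicE; case: ifPn => _;
  rewrite ?mul1e ?mul0e.
Qed.

Let integral_density_nnsfun (f : {nnsfun T >-> R}) :
  (\int[nu]_x (f x)%:E = \int[mu]_x ((f x)%:E * (g x)%:E))%E.
Proof.
have mg' : measurable_fun setT (EFin \o g) by exact/measurable_EFinP.
under [LHS]eq_integral do rewrite fimfunE -fsumEFin//.
rewrite [LHS]ge0_integral_fsum//; last 2 first.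
  - by move=> r; exact/measurable_EFinP/measurableT_comp.
  - by move=> n x _; rewrite EFinM nnfun_muleindic_ge0.
under [RHS]eq_integral.
  move=> x xD; rewrite fimfunE -fsumEFin// ge0_mule_fsuml; last first.
    by move=> r; rewrite EFinM nnfun_muleindic_ge0.
  over.
rewrite [RHS]ge0_integral_fsum//; last 2 first.
  - move=> r; apply: emeasurable_funM => //.
    by apply/measurable_EFinP; apply/measurableT_comp.
  - move=> n x _; apply: mule_ge0; last by rewrite lee_fin.
    by rewrite EFinM nnfun_muleindic_ge0.
apply: eq_fsbigr => r _.
rewrite integralZl_indic_nnsfun//= integral_density_indic//.
have [r0|r0] := leP 0 r.
  rewrite -ge0_integralZl//.
  - by apply: eq_integral => x _; rewrite EFinM muleA.
  - apply: emeasurable_funM => //.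
    by apply/measurable_EFinP; exact: measurable_indic.
  - by move=> x _; rewrite mule_ge0 ?lee_fin.
(* A negative value has empty preimage under a non-negative simple function, so both integrals
   vanish. *)
rewrite preimage_nnfun0// [in RHS](_ : (fun x => _) = fun=> 0%E).
  rewrite integral0 (_ : (fun x => _) = fun=> 0%E) ?integral0 ?mule0//.
  by apply/funext => x; rewrite indic0 mul0e.
by apply/funext => x; rewrite indic0 mulr0 mul0e.
Qed.

(** Agreement on measurable sets extends to simple functions by additivity, then to f by monotone
    convergence on both sides. *)
Lemma ge0_integral_density (f : T -> \bar R) : measurable_fun setT f ->
  (forall x, 0 <= f x)%E -> (\int[nu]_x f x = \int[mu]_x (f x * (g x)%:E))%E.
Proof.
move=> mf f0; pose f_ := nnsfun_approx measurableT mf.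
have fcvg x : (fun n => (f_ n x)%:E) @ \oo --> f x.
  exact: cvg_nnsfun_approx.
have nd x : {homo (fun n => f_ n x) : m n / (m <= n)%N >-> m <= n}.
  by move=> m n mn; exact/lefP/nd_nnsfun_approx.
transitivity (lim (\int[nu]_x (f_ n x)%:E @[n --> \oo])%E).
  rewrite -monotone_convergence//=.
  - by apply: eq_integral => x _; apply/esym/cvg_lim.
  - by move=> n; exact/measurable_EFinP/measurable_funTS.
  - by move=> n ? _; rewrite lee_fin.
  - by move=> x _ m n mn; rewrite lee_fin nd.
transitivity (lim (\int[mu]_x ((f_ n x)%:E * (g x)%:E) @[n --> \oo])%E).
  by apply: congr_lim; apply/funext => n; exact: integral_density_nnsfun.
rewrite -monotone_convergence//=.
- apply: eq_integral => x _. apply/cvg_lim => //.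
  by apply: cvgeZr => //; exact: fcvg.
- move=> n; apply: emeasurable_funM; apply/measurable_EFinP => //.
- by move=> n x _; rewrite mule_ge0 ?lee_fin.
- by move=> x _ m n mn; rewrite -!EFinM lee_fin ler_wpM2r// nd.
Qed.

End density.

Section normal_abs_moment.
Context {R : realType}.

(** The Gaussian exponent is halved: one half leaves a normal density of deviation sqrt 2 sg, the
    other absorbs |x|. With y = x^2 / (4 sg^2), the bound |x| <= sg (1 + y) <= sg e^y is a completed
    square followed by the exponential inequality. *)
Lemma normal_pdf_abs_le (sg x : R) : 0 < sg ->
  `|x| * normal_pdf 0 sg x <=
  Num.sqrt 2 * sg * normal_pdf 0 (Num.sqrt 2 * sg) x.
Proof.
move=> sg0; have q0 : 0 < Num.sqrt 2 :> R by rewrite sqrtr_gt0.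
have sgN : sg != 0 by rewrite gt_eqF.
rewrite !normal_pdfE ?mulf_neq0 ?(gt_eqF q0)//.
have peak : normal_peak (Num.sqrt 2 * sg) = (Num.sqrt 2)^-1 * normal_peak sg.
  rewrite /normal_peak exprMn sqr_sqrtr// -invfM -sqrtrM//.
  by congr (Num.sqrt _)^-1; ring.
rewrite peak /normal_fun !subr0 exprMn sqr_sqrtr//.
set y := x ^+ 2 / (2 ^+ 2 * sg ^+ 2).
have -> : - x ^+ 2 / (sg ^+ 2 *+ 2) = - y - y by rewrite /y; field.
have -> : - x ^+ 2 / ((2 * sg ^+ 2) *+ 2) = - y by rewrite /y; field.
rewrite expRD.
have -> : Num.sqrt 2 * sg * ((Num.sqrt 2)^-1 * normal_peak sg * expR (- y))
    = sg * (normal_peak sg * expR (- y)).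
  by field; rewrite gt_eqF.
have -> : `|x| * (normal_peak sg * (expR (- y) * expR (- y)))
    = normal_peak sg * expR (- y) * (`|x| * expR (- y)) by ring.
rewrite [leRHS]mulrC ler_wpM2l ?mulr_ge0 ?normal_peak_ge0 ?expR_ge0//.
rewrite expRN ler_pdivrMr ?expR_gt0//.
apply: le_trans (_ : _ <= sg * (1 + y)) _; last first.
  by rewrite ler_wpM2l ?(ltW sg0)// expR_ge1Dx.
rewrite -subr_ge0 (_ : _ - _ = sg * (`|x| / (2 * sg) - 1) ^+ 2).
  by rewrite mulr_ge0 ?sqr_ge0 ?(ltW sg0).
by rewrite /y -(real_normK (num_real x)); field.
Qed.

Lemma normal_abs_moment (sg : R) : 0 < sg ->
  (\int[normal_prob 0 sg]_x `|x|%:E <= (Num.sqrt 2 * sg)%:E)%E.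
Proof.
move=> sg0.
rewrite (@ge0_integral_density _ _ _ lebesgue_measure _ (normal_pdf 0 sg))//.
- pose tau := Num.sqrt 2 * sg.
  have tau0 : 0 <= tau by rewrite mulr_ge0 ?sqrtr_ge0 ?ltW.
  apply: (@le_trans _ _ (\int[lebesgue_measure]_x (tau%:E * (normal_pdf 0 tau x)%:E))%E).
    apply: ge0_le_integral => //.
    + by move=> x _; rewrite mule_ge0 ?lee_fin ?normal_pdf_ge0.
    + apply: emeasurable_funM; apply/measurable_EFinP.
        exact: normr_measurable.
      exact: measurable_normal_pdf.
    + apply: emeasurable_funM => //; apply/measurable_EFinP.
      exact: measurable_normal_pdf.
    + by move=> x _; rewrite -!EFinM lee_fin normal_pdf_abs_le.
  rewrite ge0_integralZl//; last 2 first.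
  + by apply/measurable_EFinP; exact: measurable_normal_pdf.
  + by move=> x _; rewrite lee_fin normal_pdf_ge0.
  by rewrite integral_normal_pdf mule1.
- by move=> x; exact: normal_pdf_ge0.
- exact: measurable_normal_pdf.
- by apply/measurable_EFinP; exact: normr_measurable.
Qed.

End normal_abs_moment.

(** * Wiener integrals of Lipschitz integrands *)

Section wiener_integrals.
Context {R : realType} {dO : measure_display} {Om : measurableType dO}.
Variables (P : probability Om R) (B : R -> Om -> R) (t : R).
Hypotheses (t0 : 0 <= t).
Hypothesis mB : forall r, 0 <= r -> measurable_fun setT (B r).

Let grid (b : R) (N i : nat) : R := b * (i%:R / N%:R).

Let step (b : R) (N : nat) (f : R -> R) (x : Om) : R :=
  \sum_(i < N) f (grid b N i) * (B (grid b N i.+1) x - B (grid b N i) x).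

Let grid_ge0 b N i : 0 <= b -> 0 <= grid b N i.
Proof. by move=> b0; rewrite mulr_ge0// divr_ge0. Qed.

Let grid_le b N i : (0 < N)%N -> 0 <= b -> (i <= N)%N -> grid b N i <= b.
Proof.
move=> N0 b0 iN; rewrite -[leRHS]mulr1 ler_wpM2l// ler_pdivrMr ?ltr0n//.
by rewrite mul1r ler_nat.
Qed.

Let gridS b N i : grid b N i.+1 = grid b N i + b / N%:R.
Proof. by rewrite /grid -[i.+1]addn1 natrD; ring. Qed.

Let measurable_step b N f : 0 <= b -> measurable_fun setT (step b N f).
Proof.
move=> b0; apply: measurable_sum => i; apply: measurable_funM => //.
by apply: measurable_funB; apply: mB; exact: grid_ge0.
Qed.

Let step_error M f b N i : lipschitz_on t M f -> 0 <= b <= t -> (i < N)%N ->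
  (\int[lebesgue_measure]_(x in `[grid b N i, grid b N i.+1])
     ((f x - f (grid b N i)) ^+ 2)%:E
   <= ((M * (b / N%:R)) ^+ 2 * (b / N%:R))%:E)%E.
Proof.
move=> [[mf fM] fL] /andP[b0 bt] iN; have N0 : (0 < N)%N by exact: leq_ltn_trans iN.
set tau := grid b N i; set h := b / N%:R.
have h0 : 0 <= h by rewrite divr_ge0.
have tau0 : 0 <= tau by exact: grid_ge0.
have tauh : tau + h <= t by rewrite -gridS (le_trans _ bt)// grid_le.
rewrite gridS -/tau -/h.
have le1 : (\int[lebesgue_measure]_(x in `[tau, (tau + h)%R]) ((f x - f tau) ^+ 2)%:E
    <= \int[lebesgue_measure]_(x in `[tau, (tau + h)%R]) ((M * h) ^+ 2)%:E)%E.
  apply: ge0_le_integral => //.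
  - by move=> x _; rewrite lee_fin sqr_ge0.
  - apply/measurable_EFinP/measurable_funTS/measurable_funX.
    exact: measurable_funB.
  - move=> x /=; rewrite in_itv /= => /andP[x1 x2]; rewrite lee_fin.
    have xt : 0 <= x <= t by rewrite (le_trans tau0)// (le_trans x2).
    have taut : 0 <= tau <= t by rewrite tau0/= (le_trans _ tauh)// lerDl.
    have M0 : 0 <= M by exact: le_trans (fM _ xt).
    rewrite -[leLHS]real_normK ?num_real// ler_pXn2r ?nnegrE ?mulr_ge0//.
    apply: le_trans (fL _ _ xt taut) _; rewrite ler_wpM2l//.
    by rewrite ger0_norm ?subr_ge0// lerBlDl.
apply: (le_trans le1); rewrite integral_cst//= lebesgue_measure_itv/= lte_fin.
case: ltP => _; last by rewrite mule0 lee_fin mulr_ge0 ?sqr_ge0.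
by rewrite -EFinB -EFinM lee_fin addrAC subrr add0r.
Qed.

Let wiener_approx M f b X (e : R) : lipschitz_on t M f -> 0 <= b <= t ->
  is_wiener_integral P B b f X -> 0 < e ->
  exists N0, forall N, (N0 < N)%N ->
    (\int[P]_x ((X x - step b N f x) ^+ 2)%:E < e%:E)%E.
Proof.
move=> fL /[dup] b0t /andP[b0 bt] [mX Xf] e0; have [delta d0 Xd] := Xf e e0.
(* The N cells contribute at most M^2 b^3 / N^2 in all; this is at most M^2 b^3 / N, which is below
   delta beyond this index. *)
exists (Num.truncn (M ^+ 2 * b ^+ 3 / delta)) => N N0.
have Np : (0 < N)%N by exact: leq_ltn_trans N0.
have NR : 0 < N%:R :> R by rewrite ltr0n.
have := Xd N (grid b N) (fun i => f (grid b N i)).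
rewrite expectation.unlock; apply.
- by rewrite /grid mul0r mulr0.
- by rewrite /grid divff ?mulr1// gt_eqF.
- by move=> i iN; rewrite gridS lerDl divr_ge0.
apply: (@le_lt_trans _ _ (\sum_(i < N) ((M * (b / N%:R)) ^+ 2 * (b / N%:R))%:E)%E).
  by apply: lee_sum => i _; exact: step_error.
rewrite sumEFin lte_fin sumr_const card_ord -[_ *+ _]mulr_natr.
have -> : (M * (b / N%:R)) ^+ 2 * (b / N%:R) * N%:R
    = M ^+ 2 * b ^+ 3 / N%:R / N%:R by field; rewrite gt_eqF.
have c0 : 0 <= M ^+ 2 * b ^+ 3 by rewrite mulr_ge0 ?sqr_ge0 ?exprn_ge0.
apply: (@le_lt_trans _ _ (M ^+ 2 * b ^+ 3 / N%:R)).
  rewrite ler_pdivrMr// ler_peMr ?ler1n// divr_ge0//; exact: ltW.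
rewrite ltr_pdivrMr// [ltRHS]mulrC -ltr_pdivrMr//.
by rewrite -truncn_lt_nat// divr_ge0// ltW.
Qed.

(** X and Y are compared with one common step integral S. Since (X - Y)^2 <= 2 ((X - S)^2 + (Y -
    S)^2), precision e / 4 for each bounds their squared L^2 distance by e. *)
Lemma wiener_integral_unique M f b X Y : lipschitz_on t M f -> 0 <= b <= t ->
  is_wiener_integral P B b f X -> is_wiener_integral P B b f Y ->
  {ae P, forall x, X x = Y x}.
Proof.
move=> fL b0t Xf Yf; have /andP[b0 _] := b0t.
have [mX _] := Xf; have [mY _] := Yf.
have mXY : measurable_fun setT (fun x => ((X x - Y x) ^+ 2)%:E).
  by apply/measurable_EFinP/measurable_funX; exact: measurable_funB.
have I0 : (\int[P]_x ((X x - Y x) ^+ 2)%:E = 0)%E.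
  apply/eqP; rewrite eq_le integral_ge0 ?andbT => [|x _]; last by rewrite lee_fin sqr_ge0.
  apply/lee_addgt0Pr => e e0; rewrite add0e.
  have e4 : 0 < e / 4 by rewrite divr_gt0.
  have [N1 H1] := wiener_approx fL b0t Xf e4.
  have [N2 H2] := wiener_approx fL b0t Yf e4.
  pose N := (maxn N1 N2).+1; pose S := step b N f.
  have mS : measurable_fun setT S by exact: measurable_step.
  have mZ (Z : Om -> R) : measurable_fun setT Z ->
      measurable_fun setT (fun x => ((Z x - S x) ^+ 2)%:E).
    by move=> mZ; apply/measurable_EFinP/measurable_funX; exact: measurable_funB.
  apply: (@le_trans _ _ (\int[P]_x (2%:E * (((X x - S x) ^+ 2)%:E
      + ((Y x - S x) ^+ 2)%:E)))%E).
    apply: ge0_le_integral => //.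
    - by move=> x _; rewrite lee_fin sqr_ge0.
    - by apply: emeasurable_funM => //; apply: emeasurable_funD; exact: mZ.
    - move=> x _; rewrite -EFinD -EFinM lee_fin -subr_ge0.
      have -> : 2 * ((X x - S x) ^+ 2 + (Y x - S x) ^+ 2) - (X x - Y x) ^+ 2
          = (X x + Y x - 2 * S x) ^+ 2 by ring.
      exact: sqr_ge0.
  rewrite ge0_integralZl//; last 2 first.
  - by apply: emeasurable_funD; exact: mZ.
  - by move=> x _; rewrite adde_ge0 ?lee_fin ?sqr_ge0.
  rewrite ge0_integralD//; last 4 first.
  - by move=> x _; rewrite lee_fin sqr_ge0.
  - exact: mZ.
  - by move=> x _; rewrite lee_fin sqr_ge0.
  - exact: mZ.
  have /ltW h1 := H1 N (leq_maxl _ _); have /ltW h2 := H2 N (leq_maxr _ _).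
  have -> : e%:E = (2%:E * ((e / 4)%:E + (e / 4)%:E))%E.
    by rewrite -EFinD -EFinM; congr EFin; field.
  by apply: lee_wpmul2l => //; exact: leeD.
have := (ae_eq_integral_abs P measurableT mXY).1.
rewrite (eq_integral (fun x => ((X x - Y x) ^+ 2)%:E)); last first.
  by move=> x _; rewrite abse_EFin ger0_norm ?sqr_ge0.
move=> /(_ I0); apply: filterS => x /(_ I) [] /eqP.
by rewrite sqrf_eq0 subr_eq0 => /eqP.
Qed.

(** The versions for f and for -f are chosen separately, so they are linked by uniqueness, up to a
    null set. A version exists for one exactly when it exists for the other; otherwise both take the
    default value 0, which is its own opposite. *)
Lemma wiener_integralN M f b : lipschitz_on t M f -> 0 <= b <= t ->
  {ae P, forall x, wiener_integral P B b (fun y => - f y) x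
                 = - wiener_integral P B b f x}.
Proof.
move=> fL b0t; have NfL := lipschitz_onN fL.
have opp (g : R -> R) (X : Om -> R) : is_wiener_integral P B b g X ->
    is_wiener_integral P B b (fun y => - g y) (fun x => - X x).
  move=> [mX Xg]; split=> [|e e0]; first exact: measurableT_comp.
  have [del d0 H] := Xg e e0; exists del => // m tau v t1 t2 t3 t4.
  have := H m tau (fun i => - v i) t1 t2 t3.
  have -> : (fun x => (X x - \sum_(i < m) - v i * (B (tau i.+1) x - B (tau i) x)) ^+ 2)
      = fun x => (- X x - \sum_(i < m) v i * (B (tau i.+1) x - B (tau i) x)) ^+ 2.
    apply/funext => x; under eq_bigr do rewrite mulNr.
    by rewrite sumrN; ring.
  apply; apply: le_lt_trans t4; rewrite le_eqVlt; apply/orP; left; apply/eqP.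
  apply: eq_bigr => i _; apply: eq_integral => y _; congr EFin.
  by ring.
rewrite /wiener_integral; case: (xgetP (fun=> 0)) => [X XE Xf|none].
  case: xgetP => [Y YE Yf|none]; last first.
    exfalso; apply: (none (fun x => - X x)) => /=.
    have -> : f = fun y => - - f y by apply/funext => y; rewrite opprK.
    exact: opp.
  exact: wiener_integral_unique NfL b0t Xf (opp _ _ Yf).
case: xgetP => [Y YE Yf|_]; last by apply: aeW => x; rewrite oppr0.
by exfalso; apply: (none (fun x => - Y x)); exact: opp.
Qed.

Lemma measurable_wiener_integral b f :
  measurable_fun setT (wiener_integral P B b f).
Proof. by rewrite /wiener_integral; case: xgetP => // X _ []. Qed.

Variable C : R.
Hypothesis C0 : 0 <= C.
Hypothesis B0 : forall x, B 0 x = 0.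
Hypothesis BC : forall r, 0 <= r <= t -> (\int[P]_x `|B r x|%:E <= C%:E)%E.

(** Summation by parts shifts the differences from B to f; the boundary term at 0 vanishes because
    [B0] holds at every x. *)
Let abel b N f x : step b N f x = f (grid b N N) * B (grid b N N) x
  - \sum_(i < N) (f (grid b N i.+1) - f (grid b N i)) * B (grid b N i.+1) x.
Proof.
rewrite /step; set D := fun i => B (grid b N i) x; set v := fun i => f (grid b N i).
have D0 : D 0%N = 0 by rewrite /D /grid mul0r mulr0 B0.
rewrite -[LHS]/(\sum_(i < N) v i * (D i.+1 - D i)).
rewrite -[RHS]/(v N * D N - \sum_(i < N) (v i.+1 - v i) * D i.+1).
elim: N {v D D0}(v) (D) D0 => [|N IH] v D D0; first by rewrite !big_ord0 D0; ring.
by rewrite !big_ord_recr /= IH//; ring.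
Qed.

(* Summation by parts reduces the moment of a step integral to those of the
   B_r, uniformly over a class of Lipschitz integrands. *)
Let step_moment M f b N : lipschitz_on t M f -> 0 <= b <= t -> (0 < N)%N ->
  (\int[P]_x `|step b N f x|%:E <= (M * C + M * t * C)%:E)%E.
Proof.
move=> [[mf fM] fL] /andP[b0 bt] N0.
have NR : 0 < N%:R :> R by rewrite ltr0n.
have gt i : (i <= N)%N -> 0 <= grid b N i <= t.
  by move=> iN; rewrite grid_ge0//= (le_trans _ bt)// grid_le.
have M0 : 0 <= M by exact: le_trans (fM _ (gt _ (leqnn N))).
have mD i : measurable_fun setT (fun x => `|B (grid b N i) x|%:E).
  by apply/measurable_EFinP; apply: measurableT_comp => //; apply/mB/grid_ge0.
pose h := M * (b / N%:R); have h0 : 0 <= h by rewrite mulr_ge0// divr_ge0.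
apply: (@le_trans _ _ (\int[P]_x (M%:E * `|B (grid b N N) x|%:E
    + \sum_(i < N) h%:E * `|B (grid b N i.+1) x|%:E))%E).
  apply: ge0_le_integral => //.
  - apply/measurable_EFinP; apply: measurableT_comp => //; exact: measurable_step.
  - apply: emeasurable_funD; first exact: emeasurable_funM.
    by apply: emeasurable_sum => i _; exact: emeasurable_funM.
  - move=> x _; under [X in (_ <= _ + X)%E]eq_bigr do rewrite -EFinM.
    rewrite -EFinM sumEFin -EFinD lee_fin abel.
    apply: le_trans (ler_normB _ _) _; apply: lerD.
      by rewrite normrM ler_wpM2r// fM// gt.
    apply: le_trans (ler_norm_sum _ _ _) _; apply: ler_sum => i _.
    rewrite normrM ler_wpM2r// /h.
    apply: le_trans (fL _ _ (gt _ _) (gt _ _)) _ => //; first exact: ltnW.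
    by rewrite ler_wpM2l// gridS addrAC subrr add0r ger0_norm// divr_ge0.
rewrite ge0_integralD//; last 4 first.
- by move=> x _; rewrite mule_ge0 ?lee_fin.
- exact: emeasurable_funM.
- by move=> x _; apply: sume_ge0 => i _; rewrite mule_ge0 ?lee_fin.
- by apply: emeasurable_sum => i _; exact: emeasurable_funM.
rewrite EFinD; apply: leeD.
  rewrite ge0_integralZl//; try by move=> *; rewrite lee_fin.
  rewrite EFinM; apply: lee_wpmul2l; first by rewrite lee_fin.
  by apply: BC; exact: gt.
rewrite ge0_integral_sum//; last 2 first.
- by move=> i; exact: emeasurable_funM.
- by move=> i x _; rewrite mule_ge0 ?lee_fin.
apply: (@le_trans _ _ (\sum_(i < N) (h * C)%:E)%E).
  apply: lee_sum => i _; rewrite ge0_integralZl//; try by move=> *; rewrite lee_fin.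
  rewrite (EFinM h C); apply: lee_wpmul2l; first by rewrite lee_fin.
  by apply: BC; exact: gt.
rewrite sumEFin lee_fin sumr_const card_ord -[_ *+ _]mulr_natr.
have -> : h * C * N%:R = M * b * C by rewrite /h; field; rewrite gt_eqF.
by rewrite ler_wpM2r// ler_wpM2l.
Qed.

(** Compare with a step integral S at squared L^2 distance below 1: |X - S| <= 1 + (X - S)^2 has
    integral at most 2, and the rest bounds S. The default version 0 satisfies the same bound. *)
Lemma wiener_integral_moment M f b : lipschitz_on t M f -> 0 <= b <= t ->
  (\int[P]_x `|wiener_integral P B b f x|%:E
   <= (2 + (M * C + M * t * C))%:E)%E.
Proof.
move=> fL b0t; have /andP[b0 _] := b0t.
have z0 : 0 <= (0 : R) <= t by rewrite lexx.
have M0 : 0 <= M by have [[_ fM] _] := fL; exact: le_trans (fM _ z0).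
rewrite /wiener_integral; case: xgetP => [X _ Xf|_]; last first.
  under eq_integral do rewrite normr0.
  by rewrite integral0 lee_fin !addr_ge0 ?mulr_ge0.
have [mX _] := Xf; have [N1 H] := wiener_approx fL b0t Xf ltr01.
pose N := N1.+1; pose S := step b N f.
have mS : measurable_fun setT S by exact: measurable_step.
have mXS : measurable_fun setT (fun x => ((X x - S x) ^+ 2)%:E).
  by apply/measurable_EFinP/measurable_funX; exact: measurable_funB.
have mnS : measurable_fun setT (fun x => `|S x|%:E).
  by apply/measurable_EFinP; exact: measurableT_comp.
apply: (@le_trans _ _ (\int[P]_x (1%:E + ((X x - S x) ^+ 2)%:E + `|S x|%:E))%E).
  apply: ge0_le_integral => //.
  - by apply/measurable_EFinP; exact: measurableT_comp.
  - by apply: emeasurable_funD => //; exact: emeasurable_funD.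
  - move=> x _; rewrite -!EFinD lee_fin.
    rewrite -[X in `|X|](subrK (S x)) (le_trans (ler_normD _ _))// lerD2r.
    rewrite -[X in _ <= _ + X]real_normK ?num_real//.
    set y := `|_|; rewrite -subr_ge0.
    have -> : 1 + y ^+ 2 - y = (y - 2^-1) ^+ 2 + 3 / 4 by field.
    by rewrite addr_ge0 ?sqr_ge0// divr_ge0.
rewrite ge0_integralD//; last 2 first.
- by move=> x _; rewrite adde_ge0 ?lee_fin ?sqr_ge0.
- exact: emeasurable_funD.
rewrite EFinD; apply: leeD; last exact: step_moment.
rewrite ge0_integralD//; last by move=> x _; rewrite lee_fin sqr_ge0.
rewrite integral_cst// [X in (_ * X)%E]probability_setT mule1.
rewrite (_ : 2%:E = 1%:E + 1%:E)%E; last by rewrite -EFinD.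
by rewrite leeD2l// ltW// H.
Qed.

End wiener_integrals.

(** * Almost sure summability *)

Section almost_everywhere.
Context {R : realType} {dO : measure_display} {Om : measurableType dO}.
Variable P : {measure set Om -> \bar R}.

Lemma ae_forall_countable (T : countType) (Q : T -> Om -> Prop) :
  (forall i, {ae P, forall x, Q i x}) -> {ae P, forall x, forall i, Q i x}.
Proof.
move=> Qi; have : {ae P, forall x, forall n, if pickle_inv n is Some i then Q i x else True}.
  apply: ae_foralln => n; case: (pickle_inv n) => [i|]; first exact: Qi.
  exact: aeW.
by apply: filterS => x Qx i; have := Qx (pickle i); rewrite pickleK_inv.
Qed.

(** Transfers unordered sums to series over the natural numbers, where sum and integral can be
    exchanged. *)
Lemma esum_countable (T : countType) (a : T -> \bar R) : (forall i, (0 <= a i)%E) ->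
  (\esum_(i in [set: T]) a i = \sum_(n <oo) oapp a 0 (pickle_inv n))%E.
Proof.
move=> a0; pose g n : \bar R := oapp a 0%E (@pickle_inv T n).
have g0 n : (0 <= g n)%E by rewrite /g; case: pickle_inv.
rewrite -[RHS]/(\sum_(n <oo) g n)%E nneseries_esumT//.
have -> : (\esum_(n in [set: nat]) g n
    = \esum_(n in [set: nat]) if n \in range (@pickle T) then g n else 0)%E.
  apply: eq_esum => n _; case: ifPn => //; rewrite notin_setE /g => nr.
  case E : (pickle_inv n) => [i|//]; exfalso; apply: nr; exists i => //.
  by have := pickle_invK (T := T) n; rewrite E.
rewrite -esum_mkcond esum_image; last first.
  by move=> i j _ _; exact: (pcan_inj (@pickleK_inv T)).
by apply: eq_esum => i _; rewrite /g pickleK_inv.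
Qed.

Lemma ae_abs_summable (T : countType) (f : T -> Om -> R) (c : T -> R) :
  (forall i, measurable_fun setT (f i)) ->
  (forall i, (\int[P]_x `|f i x|%:E <= (c i)%:E)%E) ->
  abs_summable c -> {ae P, forall x, abs_summable (f^~ x)}.
Proof.
move=> mf fc sc.
pose g n x : \bar R := oapp (fun i => `|f i x|%:E) 0%E (@pickle_inv T n).
have g0 n x : (0 <= g n x)%E by rewrite /g; case: pickle_inv => //= i; rewrite lee_fin.
have mg n : measurable_fun setT (g n).
  rewrite /g; case: pickle_inv => [i|]/=; last exact: measurable_cst.
  by apply/measurable_EFinP; exact: measurableT_comp.
have c0 i : 0 <= c i.
  by rewrite -lee_fin (le_trans _ (fc i))// integral_ge0// => x _; rewrite lee_fin.
have E x : (\esum_(i in [set: T]) `|f i x|%:E = \sum_(n <oo) g n x)%E.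
  by rewrite esum_countable// => i; rewrite lee_fin.
have fin : (\int[P]_x (\sum_(n <oo) g n x) < +oo)%E.
  rewrite integral_nneseries//; apply: le_lt_trans sc.
  rewrite esum_countable => [|i]; last by rewrite lee_fin.
  apply: lee_nneseries => [n _ _|n _]; first exact: integral_ge0.
  rewrite /g; case: pickle_inv => [i|]/=; last by rewrite integral0.
  by rewrite ger0_norm.
have s0 x : (0 <= \sum_(n <oo) g n x)%E by apply: nneseries_ge0 => n _ _.
have int : P.-integrable setT (fun x => \sum_(n <oo) g n x)%E.
  apply/integrableP; split.
    by apply: ge0_emeasurable_sum => [n x _ _|n _]; [exact: g0|exact: mg].
  by under eq_integral do rewrite gee0_abs//.
have := integrable_ae measurableT int; apply: filterS => x /(_ I).
by rewrite /abs_summable E ge0_fin_numE.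
Qed.

End almost_everywhere.

Section brownian_increments.
Context {R : realType} {dO : measure_display} {Om : measurableType dO}.
Variables (P : probability Om R) (B : R -> Om -> R).
Hypothesis BB : brownian P B.

Lemma brownian_increment_moment (r0 r : R) : 0 <= r0 -> 0 <= r ->
  (\int[P]_x `|B (r0 + r) x - B r0 x|%:E <= (Num.sqrt 2 * Num.sqrt r)%:E)%E.
Proof.
(* The normal law is given only for increments between distinct times, so r = 0 is treated apart. *)
move=> r00; rewrite le_eqVlt => /predU1P[<-|r_gt0].
  under eq_integral do rewrite addr0 subrr normr0.
  by rewrite integral0 sqrtr0 mulr0.
have [mB _ law _ _] := BB.
have mD : measurable_fun setT
    (fun x => B (r0 + r) x - B r0 x : measurableTypeR R).
  by apply: measurable_funB; apply: mB; rewrite ?addr_ge0// ltW.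
pose X : {mfun Om >-> measurableTypeR R} :=
  HB.pack (fun x => B (r0 + r) x - B r0 x) (isMeasurableFun.Build _ _ _ _ _ mD).
have mn : measurable_fun setT (fun y : measurableTypeR R => `|y|%:E).
  by apply/measurable_EFinP; exact: normr_measurable.
have := @ge0_integral_distribution _ _ _ _ _ P X (fun y => `|y|%:E) mn.
move=> /(_ (fun y => normr_ge0 y)) /= <-.
have sr : 0 < Num.sqrt r by rewrite sqrtr_gt0.
rewrite (@eq_measure_integral _ _ _ setT (normal_prob 0 (Num.sqrt r))).
  exact: normal_abs_moment.
move=> A mA _; have := law r0 (r0 + r) A.
by rewrite [r0 + r - r0]addrAC subrr add0r; apply => //; rewrite r00 ltrDl.
Qed.

End brownian_increments.

(** * The stochastic map *)

(** The symbol at k is the k-th coefficient of the image of the k-th mode, which is bounded by the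
    norm of that image and so by the Hilbert-Schmidt norm. *)
Lemma hilbert_schmidt_symbol_bounded {R : realType} (A : Hs R 0 -> Hs R 2)
    (phi : int -> R[i]) : fourier_diagonal A phi -> hilbert_schmidt A ->
  exists C : R, forall k, cabs (phi k) <= C.
Proof.
move=> Ad; rewrite /hilbert_schmidt; set E := esum _ _ => Efin.
have E0 : (0 <= E)%E by apply: esum_ge0 => k _; rewrite lee_fin sqr_ge0.
have /fineK EE : E \is a fin_num by rewrite ge0_fin_numE.
exists (Num.sqrt (fine E)) => k.
have -> : phi k = A (fourier_mode 0 k) k by rewrite Ad /= eqxx mulr1.
apply: le_trans (cabs_coef_le _ _) _.
apply: (@le_trans _ _ `|A (fourier_mode 0 k)|).
  by rewrite -[leRHS]mulr1 ler_wpM2l// decay_le1.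
rewrite -[leLHS]ger0_norm// -sqrtr_sqr ler_sqrt ?fine_ge0// -lee_fin EE.
apply: esum_ge; exists [set k]; first by split=> //; exact: finite_set1.
by rewrite fsbig_set1.
Qed.

Section stochastic_stage.
Context {R : realType} {dO : measure_display} {Om : measurableType dO}.
Variables (P : probability Om R) (W : int -> R -> Om -> R).
Hypothesis hW : driving_noise P W.
Variables (s : R) (d : nat) (gam : 'I_d -> R) (t : R).
Hypotheses (s1 : 1 < s) (t0 : 0 < t) (gam_inj : injective gam).
Variables (kap : R) (phi : int -> R[i]) (Cphi : R).
Hypotheses (phi_real : forall k, (phi k)^*%C = phi k).
Hypotheses (phi_even : forall k, phi k = phi (- k)).
Hypothesis phi_le : forall k, cabs (phi k) <= Cphi.
Variables (n p : nat) (c : R).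
Hypothesis c01 : 0 <= c <= 1.
Local Notation C := R[i].
Local Notation Hs := (Hs R s).

Let Wn := increment t W n.

Let ct : 0 <= c * t <= t.
Proof.
by move/andP: c01 => [c0 c1]; rewrite mulr_ge0 ?(ltW t0)//= ler_piMl// ltW.
Qed.

Let integrand (a : int) (y : R) : C := Posc gam t a y * (y ^+ p)%:C%C.

Let noise (k a : int) (x : Om) : C :=
  cwiener_integral P (Wn k) (c * t) (integrand a) x.

Let nt0 r : 0 <= r -> 0 <= n%:R * t + r.
Proof. by move=> r0; rewrite addr_ge0// mulr_ge0// ltW. Qed.

Let measurable_Wn k r : 0 <= r -> measurable_fun setT (Wn k r).
Proof.
have [Wb _ _] := hW; have [mW _ _ _ _] := Wb k.
move=> r0; apply: measurable_funB; apply: mW; first exact: nt0.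
by rewrite -[_ * _]addr0 nt0.
Qed.

Let Wn_even k : Wn (- k) = Wn k.
Proof.
have [_ We _] := hW; apply/funext => r; apply/funext => x.
by rewrite /Wn /increment !We.
Qed.

Let integrandN a y : integrand (- a) y = (integrand a y)^*%C.
Proof.
rewrite /integrand (Posc_conj t0 gam_inj).
by case: (Posc _ _ _ _) => e f; apply: eq_ReIm => /=; ring.
Qed.

(** Negating the frequency conjugates the integrand. Its real part is then the same function, hence
    has the same chosen version; only the imaginary part changes sign and needs a null set, one for
    each of countably many pairs. *)
Let noise_herm : {ae P, forall x, forall q : int * int,
  noise (- q.1) (- q.2) x = (noise q.1 q.2 x)^*%C}.
Proof.
have [M PM] := Posc_monomial_lipschitz t0 gam_inj p.
apply: ae_forall_countable => -[k a] /=; have [_ LI] := PM a.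
have := @wiener_integralN _ _ _ P (Wn k) t (@measurable_Wn k) _ _ _ LI ct.
apply: filterS => x E; rewrite /noise /cwiener_integral Wn_even.
apply: eq_ReIm => /=.
  congr (wiener_integral _ _ _ _ _); apply/funext => y.
  by rewrite integrandN; case: (integrand a y).
rewrite -E; congr (wiener_integral _ _ _ _ _).
by apply/funext => y; rewrite integrandN /integrand; case: (_ * _).
Qed.

(** Uniformity in k and a: the increments of every W_k obey one moment bound on [0, t], and all
    integrands share one Lipschitz constant. *)
Let noise_moment : exists M : R, forall k a,
  (\int[P]_x (`|Re (noise k a x)| + `|Im (noise k a x)|)%:E <= M%:E)%E.
Proof.
have [M PM] := Posc_monomial_lipschitz t0 gam_inj p.
pose D := Num.sqrt 2 * Num.sqrt t : R.
have WnD k r : 0 <= r <= t -> (\int[P]_x `|Wn k r x|%:E <= D%:E)%E.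
  move=> /andP[r0 rt]; have [Wb _ _] := hW.
  have nt : 0 <= n%:R * t by rewrite mulr_ge0// ltW.
  apply: le_trans (brownian_increment_moment (Wb k) nt r0) _.
  by rewrite lee_fin ler_wpM2l// ler_sqrt// ltW.
have Wn0 k x : Wn k 0 x = 0 by rewrite /Wn /increment addr0 subrr.
have D0 : 0 <= D by rewrite mulr_ge0.
pose N := 2 + (M * D + M * t * D).
exists (N + N) => k a; have [LR LI] := PM a.
have mn f : measurable_fun setT (fun x => `|wiener_integral P (Wn k) (c * t) f x|%:E).
  by apply/measurable_EFinP; apply: measurableT_comp => //; exact: measurable_wiener_integral.
under eq_integral do rewrite EFinD.
rewrite ge0_integralD//; [|exact: mn..].
rewrite EFinD; apply: leeD.
  exact: (@wiener_integral_moment _ _ _ P (Wn k) t (ltW t0) (@measurable_Wn k) D D0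
    (Wn0 k) (@WnD k) _ _ _ LR ct).
exact: (@wiener_integral_moment _ _ _ P (Wn k) t (ltW t0) (@measurable_Wn k) D D0
    (Wn0 k) (@WnD k) _ _ _ LI ct).
Qed.

Let kernel (x : Om) (k : int) (j : int * int) : C :=
  phi j.2 * noise j.2 (k * j.2 + j.1 * j.2) x.

Let kernel_summable : {ae P, forall x, abs_summable (fun q : int * int =>
  decay s q.1 * decay s q.2 * cabs (kernel x q.1 (q.2, q.1 - q.2)))}.
Proof.
have [M NM] := noise_moment.
have C0 : 0 <= Cphi by exact: le_trans (cabs_ge0 _) (phi_le 0).
pose a (q : int * int) := q.1 * (q.1 - q.2) + q.2 * (q.1 - q.2).
pose z (q : int * int) x := noise (q.1 - q.2) (a q) x.
pose w (q : int * int) := decay s q.1 * decay s q.2 * Cphi.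
have w0 q : 0 <= w q by rewrite !mulr_ge0 ?decay_ge0.
pose f (q : int * int) x := w q * (`|Re (z q x)| + `|Im (z q x)|).
have f0 q x : 0 <= f q x by rewrite mulr_ge0 ?addr_ge0.
have mf q : measurable_fun setT (fun x => `|Re (z q x)| + `|Im (z q x)|).
  by apply: measurable_funD; apply: measurableT_comp => //; exact: measurable_wiener_integral.
have : {ae P, forall x, abs_summable (f^~ x)}.
  apply: (@ae_abs_summable _ _ _ _ _ f (fun q => w q * M)) => [q|q|].
  - exact: measurable_funM.
  - under eq_integral do rewrite ger0_norm// EFinM.
    rewrite ge0_integralZl//; last 2 first.
    + by apply/measurable_EFinP; exact: mf.
    + by rewrite lee_fin.
    by rewrite (EFinM (w q)); apply: lee_wpmul2l; [rewrite lee_fin|exact: NM].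
  have := abs_summableZ (Cphi * M)
    (abs_summable_prod (decay_summable s1) (decay_summable s1)).
  by congr abs_summable; apply/funext => q; rewrite /w; ring.
apply: filterS => x; apply: le_abs_summable => q.
rewrite [leRHS]ger0_norm// ger0_norm ?mulr_ge0 ?decay_ge0 ?cabs_ge0//.
rewrite /f /w -[leRHS]mulrA ler_wpM2l ?mulr_ge0 ?decay_ge0// /kernel cabsM.
by rewrite ler_pM ?cabs_ge0// cabs_le.
Qed.

Lemma Pmap_hamiltonian : {ae P, forall x, forall (L U : Hs -> Hs) u a b,
  differentiable L u -> differentiable U u ->
  (\forall v \near u, forall k,
     L v k = Pmap gam t P kap phi (increment t W n) x p c (U v) k) ->
  sform ('d L u a) ('d U u b) + sform ('d U u a) ('d L u b) = 0}.
Proof.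
apply: filterS2 noise_herm kernel_summable => x herm summ L U u a b dL dU LE.
apply: (@convolution_hamiltonian _ s s1 (kernel x) summ _
  (kap * (t `^ (p%:R + 2^-1))^-1) _ _ _ _ _ dL dU).
  (* Exchanging k and k1 turns k2 into -k2 and negates the phase. Evenness and reality of [phi] make
     its factor self-conjugate, and [herm] treats the other factor. *)
  move=> k k1 k2 kE; rewrite /kernel [(k, - k2).2]/= [(k, - k2).1]/= -phi_even.
  have -> : k1 * - k2 + k * - k2 = - (k * k2 + k1 * k2) by ring.
  have := herm (k2, k * k2 + k1 * k2); rewrite ![(k2, _).1]/= ![(k2, _).2]/= => ->.
  rewrite ![(k1, k2).1]/= ![(k1, k2).2]/= -[in LHS]phi_real.
  move: (phi k2) (noise k2 _ x) => [e f] [g h].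
  by apply: eq_ReIm => /=; ring.
apply: filterS LE => v LE k; rewrite LE /Pmap; congr (_ * _).
  by rewrite rmorphM mulrA.
rewrite /csum; congr Complex; congr rsum; apply/funext => j.
  by rewrite /kernel mulrA.
by rewrite /kernel mulrA.
Qed.

End stochastic_stage.

(** * The scheme *)

Lemma diff_lincomb {R : realType} {V : normedModType R} (I : finType)
    (c : I -> R) (X : I -> V -> V) (u : V) :
  (forall i, differentiable (X i) u) ->
  differentiable (fun v => v + \sum_i c i *: X i v) u /\
  forall h, 'd (fun v => v + \sum_i c i *: X i v) u h
          = h + \sum_i c i *: 'd (X i) u h.
Proof.
move=> dX; suff D (r : seq I) : is_diff u (fun v => v + \sum_(i <- r) c i *: X i v)
    (fun h => h + \sum_(i <- r) c i *: 'd (X i) u h).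
  by have Du := D (index_enum I); split=> [|h]; [exact: ex_diff|rewrite diff_val].
elim: r => [|i r IH].
  have -> : (fun v => v + \sum_(i <- [::]) c i *: X i v) = id.
    by apply/funext => v; rewrite big_nil addr0.
  have -> : (fun h => h + \sum_(i <- [::]) c i *: 'd (X i) u h) = id.
    by apply/funext => v; rewrite big_nil addr0.
  exact: is_diff_id.
have Di : is_diff u (X i) ('d (X i) u) by exact: differentiableP.
have := is_diffD IH (is_diffZ (c i) Di).
have -> : (fun v => v + \sum_(i <- r) c i *: X i v) + c i *: X i
    = (fun v => v + \sum_(j <- i :: r) c j *: X j v).
  by apply/funext => v; rewrite big_cons [in RHS]addrCA addrC.
have -> : (fun h => h + \sum_(i <- r) c i *: 'd (X i) u h) + c i *: ('d (X i) u : V -> V)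
    = (fun h => h + \sum_(j <- i :: r) c j *: 'd (X j) u h).
  by apply/funext => v; rewrite big_cons [in RHS]addrCA addrC.
by [].
Qed.

Lemma linear_isometry_continuous {R : realType} {V W : normedModType R}
    (f : {linear V -> W}) : (forall u, `|f u| = `|u|) -> continuous f.
Proof.
move=> fi u; apply/cvgrPdist_lt => e e0; near=> v.
rewrite -raddfB fi; near: v.
by apply: (@cvgr_dist_lt _ _ _ (nbhs u) _ id u); first exact: cvg_id.
Unshelve. all: by end_near.
Qed.

Lemma diff_linear_comp {R : realType} {U V W : normedModType R}
    (f : {linear V -> W}) (G : U -> V) (u : U) : continuous f ->
  differentiable G u -> differentiable (fun v => f (G v)) u /\
  forall h, 'd (fun v => f (G v)) u h = f ('d G u h).
Proof.
move=> fc dG; have df : differentiable f (G u) by exact: linear_differentiable.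
have E1 : 'd (f \o G) u = 'd f (G u) \o 'd G u :> (_ -> _) := diff_comp dG df.
have E2 : 'd f (G u) = f :> (_ -> _) := diff_lin _ fc.
split=> [|h]; first exact: (differentiable_comp dG df).
by rewrite -[LHS]/('d (f \o G) u h) E1 /= E2.
Qed.

Section schrodinger_group.
Context {R : realType} {s : R}.
Local Notation Hs := (Hs R s).

Lemma schrodinger_is_linear (t : R) : linear (schrodinger t : Hs -> Hs).
Proof.
move=> a u v; apply: Hs_eqP => k.
rewrite -[LHS]/(cis (- (t * k%:~R ^+ 2)) * (a *: u + v) k) !Defs.coefD !Defs.coefZ.
by rewrite -![schrodinger t _ k]/(cis (- (t * k%:~R ^+ 2)) * _); ring.
Qed.

HB.instance Definition _ (t : R) := GRing.isLinear.Build R Hs Hs *:%R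
  (schrodinger t) (schrodinger_is_linear t).

Lemma schrodinger_isometry (t : R) (u : Hs) : `|schrodinger t u| = `|u|.
Proof.
rewrite -[LHS]/(Hs_norm _) -[RHS]/(Hs_norm _) /Hs_norm.
congr (Num.sqrt (fine _)); apply: eq_esum => k _.
by rewrite /= sqncM sqnc_cis mul1r.
Qed.

Lemma schrodinger_continuous (t : R) : continuous (schrodinger t : Hs -> Hs).
Proof. exact: linear_isometry_continuous (@schrodinger_isometry t). Qed.

Lemma diff_schrodinger_comp (t : R) (G : Hs -> Hs) u : differentiable G u ->
  differentiable (fun v => schrodinger t (G v)) u /\
  forall h, 'd (fun v => schrodinger t (G v)) u h = schrodinger t ('d G u h).
Proof. exact: diff_linear_comp (@schrodinger_continuous t). Qed.

End schrodinger_group.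

Section scheme_differential.
Context {R : realType} {s : R} (S : nat) (t : R).
Variables (a : 'I_2 -> stage S -> stage S -> R) (b : 'I_2 -> stage S -> R).
Variables K L : stage S -> Hs R s -> Hs R s.

Let I : finType := ('I_2 * stage S)%type.

(* The two kinds of increments are treated as one family, with the step sizes
   t and sqrt t absorbed into the Runge-Kutta coefficients. *)
Definition increments (i : I) : Hs R s -> Hs R s :=
  if i.1 == ord0 then K i.2 else L i.2.

Definition step_size (i : 'I_2) : R := if i == ord0 then t else Num.sqrt t.

Lemma sum_increments (c : 'I_2 -> stage S -> R) (u : Hs R s) :
  \sum_(i : I) (step_size i.1 * c i.1 i.2) *: increments i u
  = t *: (\sum_al c ord0 al *: K al u) + Num.sqrt t *: (\sum_al c ord_max al *: L al u).
Proof.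
rewrite -(pair_bigA _ (fun i al => (step_size i * c i al) *: increments (i, al) u)).
rewrite big_ord_recl big_ord1 /= !scaler_sumr /step_size /increments /=.
congr (_ + _); apply: eq_bigr => al _; rewrite scalerA//.
by congr ((_ * c _ _) *: _); apply: val_inj.
Qed.

Lemma stage_valueE al : stage_value t a K L al =
  fun u => u + \sum_(i : I) (step_size i.1 * a i.1 al i.2) *: increments i u.
Proof.
apply/funext => u; rewrite (sum_increments (fun i => a i al)) addrA.
by [].
Qed.

Lemma rk_stepE : rk_step t b K L = fun u =>
  schrodinger t (u + \sum_(i : I) (step_size i.1 * b i.1 i.2) *: increments i u).
Proof.
by apply/funext => u; rewrite sum_increments /rk_step !raddfD /= !linearZ /= addrA.
Qed.

End scheme_differential.

Lemma rk_step_symplectic {R : realType} {s : R} (s1 : 1 < s) (S : nat) (t : R)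
    (a : 'I_2 -> stage S -> stage S -> R) (b : 'I_2 -> stage S -> R)
    (K L : stage S -> Hs R s -> Hs R s) (u : Hs R s) :
  (forall (al be : stage S) (i j : 'I_2),
    b i al * b j be - b i al * a j al be - b j be * a i be al = 0) ->
  (forall al, differentiable (K al) u /\ differentiable (L al) u) ->
  (forall al h1 h2, differentiable (stage_value t a K L al) u ->
     sform ('d (K al) u h1) ('d (stage_value t a K L al) u h2)
     + sform ('d (stage_value t a K L al) u h1) ('d (K al) u h2) = 0 /\
     sform ('d (L al) u h1) ('d (stage_value t a K L al) u h2)
     + sform ('d (stage_value t a K L al) u h1) ('d (L al) u h2) = 0) ->
  differentiable (rk_step t b K L) u /\
  forall h1 h2, omega ('d (rk_step t b K L) u h1) ('d (rk_step t b K L) u h2)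
              = omega h1 h2.
Proof.
move=> hab dKL ham; pose I : finType := ('I_2 * stage S)%type.
have dX (i : I) : differentiable (increments K L i) u.
  by have [dK dL] := dKL i.2; rewrite /increments; case: ifP.
pose A (i j : I) := step_size t j.1 * a j.1 i.2 j.2.
pose B (i : I) := step_size t i.1 * b i.1 i.2.
have dU al : differentiable (stage_value t a K L al) u /\ forall h,
    'd (stage_value t a K L al) u h = h + \sum_(j : I)
      (step_size t j.1 * a j.1 al j.2) *: 'd (increments K L j) u h.
  by rewrite stage_valueE; exact: diff_lincomb.
have [dG GE] := diff_lincomb B dX.
have [dR RE] := diff_schrodinger_comp t dG.
rewrite rk_stepE; split=> // h1 h2.
have E h := etrans (RE h) (congr1 (schrodinger t) (GE h)).
apply: etrans (congr2 omega (E h1) (E h2)) _.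
rewrite !(omegaE s1) sform_schrodinger; congr (0 +i* (2 * _))%C.
apply: (rk_form_invariance (A := A)).
- by move=> y z1 z2; rewrite sformDr.
- by move=> z y1 y2; rewrite sformDl.
- by move=> y r z; rewrite sformZr.
- by move=> z r y; rewrite sformZl.
(* With the step sizes absorbed, the condition on the coefficients is only multiplied by the product
   of the two step sizes. *)
- move=> [i al] [j be]; rewrite /A /B /=.
  by rewrite -[RHS](mulr0 (step_size t i * step_size t j)) -(hab al be i j); ring.
move=> i; have [dUi UE] := dU i.2.
have [hK hL] := ham i.2 h1 h2 dUi.
apply: etrans (congr2 +%R (congr1 (sform _) (esym (UE h2)))
  (congr1 (sform^~ _) (esym (UE h1)))) _.
have [->|->] : increments K L i = K i.2 \/ increments K L i = L i.2.
  by rewrite /increments; case: ifP; [left|right].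
  exact: hK.
exact: hL.
Qed.

Theorem theorem5p1 (R : realType) (dO : measure_display)
    (Om : measurableType dO) (P : probability Om R)
    (W : int -> R -> Om -> R) (hW : driving_noise P W)
    (s : R) (hs : 1 < s) (lam kap t : R) (ht : 0 < t)
    (d : nat) (hd : (0 < d)%N) (gam : 'I_d -> R)
    (hgam : forall j, 0 <= gam j <= 1)
    (hgam_lt : forall i j : 'I_d, (i < j)%N -> gam i < gam j)
    (S : nat) (c : 'I_S.+1 -> R) (hc : forall q, 0 <= c q <= 1)
    (a : 'I_2 -> stage S -> stage S -> R) (b : 'I_2 -> stage S -> R)
    (Phi : Hs R 0 -> Hs R 2) (phi : int -> R[i])
    (Phi_diag : fourier_diagonal Phi phi) (Phi_HS : hilbert_schmidt Phi)
    (Phi_sa : self_adjoint Phi)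
    (phi_real : forall k, (phi k)^*%C = phi k)
    (phi_even : forall k, phi k = phi (- k))
    (hab : forall (al be : stage S) (i j : 'I_2),
      b i al * b j be - b i al * a j al be - b j be * a i be al = 0)
    (n : nat)
    (F_mass : forall (u : Hs R s) (p q : 'I_S.+1),
      mass_rate u (Fmap gam t lam p (c q) u) = 0)
    (P_mass : forall (u : Hs R s) (p q : 'I_S.+1),
      {ae P, forall x, mass_rate u
        (Pmap gam t P kap phi (increment t W n) x p (c q) u) = 0}) :
  {ae P, forall x : Om, forall (O : set (Hs R s)) (K L : stage S -> Hs R s -> Hs R s),
    open O ->
    (forall al, C1_on O (K al) /\ C1_on O (L al)) ->
    (forall u, O u -> stage_equations t a K L c
      (Fmap gam t lam) (Pmap gam t P kap phi (increment t W n) x) u) ->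
    symplectic_on O (rk_step t b K L)}.
Proof.
have gam_inj : injective gam.
  move=> i j gij; case: (ltngtP i j) => [/hgam_lt|/hgam_lt|/ord_inj//];
    by rewrite gij ltxx.
have [Cphi phi_le] := hilbert_schmidt_symbol_bounded Phi_diag Phi_HS.
(* One null set serves all the finitely many pairs (p, q) of stage parameters. *)
have Pham := ae_forall_countable (fun pq : 'I_S.+1 * 'I_S.+1 =>
  Pmap_hamiltonian hW hs ht gam_inj kap phi_real phi_even phi_le n pq.1 (hc pq.2)).
apply: filterS Pham => x Pham O K L oO KL1 eqs u Ou.
have nO : \forall v \near u, O v by exact: open_nbhs_nbhs.
have dKL al : differentiable (K al) u /\ differentiable (L al) u.
  by have [K1 L1] := KL1 al; split; [have [] := K1 u Ou|have [] := L1 u Ou].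
apply: (rk_step_symplectic hs hab dKL) => -[[p q] r] h1 h2 dU.
have [dK dL] := dKL ((p, q), r); split.
  apply: (Fmap_hamiltonian hs ht gam_inj (lam := lam) (p := p) h1 h2 (hc q) dK dU).
  by apply: filterS nO => v Ov k; have [-> _] := eqs v Ov ((p, q), r).
apply: (Pham (p, q) _ _ _ h1 h2 dL dU).
by apply: filterS nO => v Ov k; have [_ ->] := eqs v Ov ((p, q), r).
Qed.
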